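(* Let $\mathbf{X}=(X_1,\ldots,X_N)^T$ be a vector of $N\in\mathbb{N}$ input random variables fulfilling Assumption 1 (stated in the context), let $y(\mathbf{X})\in L^2(\Omega,\mathcal{F},\mathbb{P})$, and for $m\in\mathbb{N}_0$ let $$y_m(\mathbf{X})=\sum_{l=0}^m\mathbf{C}_l^T\mathbf{\Psi}_l(\mathbf{X}),\qquad \mathbf{C}_l=\mathbb{E}[y(\mathbf{X})\mathbf{\Psi}_l(\mathbf{X})],$$ be its $m$th-order generalized PCE approximation. Then the truncation error $y(\mathbf{X})-y_m(\mathbf{X})$ is orthogonal (in $L^2(\Omega,\mathcal{F},\mathbb{P})$) to $$\bigoplus_{l=0}^m\mathrm{span}\{\Psi_{\mathbf{j}}(\mathbf{X}):|\mathbf{j}|=l,\ \mathbf{j}\in\mathbb{N}_0^N\}.$$ Moreover, $\mathbb{E}[y(\mathbf{X})-y_m(\mathbf{X})]^2\to0$ as $m\to\infty$, where $\mathbb{E}[\,\cdot\,]^2$ denotes the expectation of the square, i.e. $\mathbb{E}[\{y(\mathbf{X})-y_m(\mathbf{X})\}^2]$.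
   Context: $\mathbb{N}_0=\{0,1,2,\ldots\}$. $(\Omega,\mathcal{F},\mathbb{P})$ is a complete probability space, $\mathbb{A}^N\subseteq\mathbb{R}^N$ is a bounded or unbounded subdomain, $\mathcal{B}^N$ is its Borel $\sigma$-algebra, and $\mathbb{E}$ is expectation. Here $y$ is a real-valued measurable function on $\mathbb{A}^N$, and $y(\mathbf{X})\in L^2(\Omega,\mathcal{F},\mathbb{P})$ means $\mathbb{E}[y^2(\mathbf{X})]<\infty$. Assumption 1. The random vector $\mathbf{X}:(\Omega,\mathcal{F})\to(\mathbb{A}^N,\mathcal{B}^N)$ (1) has an absolutely continuous joint distribution function and a continuous joint probability density function $f_{\mathbf{X}}$ with bounded or unbounded support $\mathbb{A}^N\subseteq\mathbb{R}^N$; (2) has absolute finite moments of all orders, i.e. $\int_{\mathbb{A}^N}|\mathbf{x}^{\mathbf{j}}|f_{\mathbf{X}}(\mathbf{x})d\mathbf{x}<\infty$ for all $\mathbf{j}\in\mathbb{N}_0^N$, where $\mathbf{x}^{\mathbf{j}}=x_1^{j_1}\cdots x_N^{j_N}$; (3) has a density $f_{\mathbf{X}}$ which either (a) has compact support, i.e. there is a compact subset $\mathbb{A}^N\subset\mathbb{R}^N$ with $\mathbb{P}(\mathbf{X}\in\mathbb{A}^N)=1$, or (b) is exponentially integrable, i.e. there is a real $\alpha>0$ with $\int_{\mathbb{A}^N}\exp(\alpha\|\mathbf{x}\|)f_{\mathbf{X}}(\mathbf{x})d\mathbf{x}<\infty$, where $\|\cdot\|$ is an arbitrary norm. For $\mathbf{j}=(j_1,\ldots,j_N)\in\mathbb{N}_0^N$,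 $|\mathbf{j}|=j_1+\cdots+j_N$; $\Pi_m^N=\mathrm{span}\{\mathbf{x}^{\mathbf{j}}:|\mathbf{j}|\le m\}$. Let $K_{N,l}=\binom{N+l-1}{l}$ be the number of multi-indices with $|\mathbf{j}|=l$, listed in a chosen monomial order as $\mathbf{j}^{(1)},\ldots,\mathbf{j}^{(K_{N,l})}$, and let $\mathbf{x}_l=(\mathbf{x}^{\mathbf{j}^{(1)}},\ldots,\mathbf{x}^{\mathbf{j}^{(K_{N,l})}})^T$. Multivariate orthogonal polynomials consistent with $f_{\mathbf{X}}(\mathbf{x})d\mathbf{x}$: a family $\{P_{\mathbf{j}}:\mathbf{j}\in\mathbb{N}_0^N\}$ with $P_{\mathbf{0}}=1$ and $P_{\mathbf{j}}\in\Pi_{|\mathbf{j}|}^N$, such that for each $l$ the column vector $\mathbf{P}_l(\mathbf{x})=(P_{\mathbf{j}^{(1)}}(\mathbf{x}),\ldots,P_{\mathbf{j}^{(K_{N,l})}}(\mathbf{x}))^T$ satisfies $\int_{\mathbb{A}^N}\mathbf{x}_r\mathbf{P}_l^T(\mathbf{x})f_{\mathbf{X}}(\mathbf{x})d\mathbf{x}=\mathbf{0}$ for all $r<l$, and the matrix $\mathbf{S}_l=\int_{\mathbb{A}^N}\mathbf{x}_l\mathbf{P}_l^T(\mathbf{x})f_{\mathbf{X}}(\mathbf{x})d\mathbf{x}$ is invertible. Orthonormal polynomials: the polynomial moment matrix $\mathbf{G}_l=\mathbb{E}[\mathbf{P}_l(\mathbf{X})\mathbf{P}_l^T(\mathbf{X})]$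 is symmetric positive-definite; fix for each $l$ a non-singular whitening matrix $\mathbf{W}_l\in\mathbb{R}^{K_{N,l}\times K_{N,l}}$ with $\mathbf{W}_l^T\mathbf{W}_l=\mathbf{G}_l^{-1}$ (with $\mathbf{W}_0=[1]$) and set $\mathbf{\Psi}_l(\mathbf{x})=\mathbf{W}_l\mathbf{P}_l(\mathbf{x})=(\Psi_{\mathbf{j}^{(1)}}(\mathbf{x}),\ldots,\Psi_{\mathbf{j}^{(K_{N,l})}}(\mathbf{x}))^T$, which defines $\Psi_{\mathbf{j}}$ for every $\mathbf{j}\in\mathbb{N}_0^N$. *)

(* Defs.v *)
From HB Require Import structures.
From mathcomp Require Import all_boot all_order all_algebra.
From mathcomp Require Import all_classical all_reals all_analysis.
From mathcomp Require Import measurable_realfun wochoice.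
Set Implicit Arguments.
Unset Strict Implicit.
Unset Printing Implicit Defensive.
Import Order.TTheory GRing.Theory Num.Theory.
Import numFieldNormedType.Exports.
Local Open Scope classical_set_scope.
Local Open Scope ring_scope.

HB.instance Definition _ (R : realType) (n : nat) :=
  @isMeasurable.Build (sigma_display (@open 'rV[R]_n)) 'rV[R]_n
    <<s @open 'rV[R]_n >> (@sigma_algebra0 _ setT _)
    (@sigma_algebraC _ _) (@sigma_algebra_bigcup _ setT _).

Section borel_rV.
Context {R : realType}.

Lemma measurable_rV_coord n (i : 'I_n) :
  measurable_fun setT (fun x : 'rV[R]_n => x ord0 i).
Proof.
apply: (measurability _ (RGenOpens.measurableE R)).
move=> _ [_ [a [b ->]] <-]; rewrite setTI.
apply: sub_sigma_algebra; apply: open_comp => //.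
by move=> x _; exact: coord_continuous.
Qed.

Lemma measurable_fun_rV d (T : measurableType d) n (f : T -> 'rV[R]_n) :
  (forall i, measurable_fun setT (fun t => f t ord0 i)) ->
  measurable_fun setT f.
Proof.
move=> mf; apply: (measurability (@open 'rV[R]_n)) => //.
move=> _ [U oU <-]; rewrite setTI.
pose B (q : 'rV[rat]_n) (k : nat) : set 'rV[R]_n :=
  [set x | forall i, `|x ord0 i - ratr (q ord0 i)| < k.+1%:R^-1].
pose F (m : nat) : set 'rV[R]_n :=
  if unpickle m is Some (q, k) then
    (if `[< B q k `<=` U >] then B q k else set0) else set0.
have -> : U = \bigcup_m F m.
  apply/seteqP; split => [x Ux|x [m _]]; last first.
    rewrite /F; case: (unpickle m) => // -[q k].
    by case: asboolP => // BU /BU.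
  have /nbhs_ballP[e /= e0 eU] : nbhs x U by exact: open_nbhs_nbhs.
  have [k ke] : exists k : nat, k.+1%:R^-1 < e / 2.
    have e20 : 0 < e / 2 by rewrite divr_gt0.
    by have [k _ /(_ k (leqnn k)) kP] := near_infty_natSinv_lt (PosNum e20); exists k => //; exact: kP.
  have qP (i : 'I_n) : exists q : rat, `|x ord0 i - ratr q| < k.+1%:R^-1.
    have : x ord0 i - k.+1%:R^-1 < x ord0 i + k.+1%:R^-1.
      by rewrite ltrBlDr -addrA ltrDl addr_gt0.
    move=> /rat_in_itvoo[q]; rewrite in_itv /= => qx; exists q.
    by rewrite distrC ltr_distl.
  have [g gP] := choice qP.
  exists (pickle (\row_i g i, k)) => //; rewrite /F pickleK.
  case: asboolP => [_ i|]; first by rewrite mxE.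
  case=> z Bz; apply: eU; split => // i j; rewrite !ord1.
  have := Bz j; rewrite mxE => zj; have xj := gP j.
  rewrite /ball /= -(subrKA (ratr (g j))) (le_lt_trans (ler_normD _ _))//.
  rewrite (splitr e) ltrD// ?(lt_trans xj ke)//.
  by rewrite distrC (lt_trans zj ke).
rewrite preimage_bigcup; apply: bigcup_measurable => m _; rewrite /F.
case: (unpickle m) => [[q k]|]; last by rewrite preimage_set0.
case: asboolP => _; last by rewrite preimage_set0.
have -> : f @^-1` B q k = \bigcap_(i in [set: 'I_n])
    ((fun t => f t ord0 i) @^-1` [set r | `|r - ratr (q ord0 i)| < k.+1%:R^-1]).
  by apply/seteqP; split => t /= Bt i //=; exact: Bt.
apply: fin_bigcap_measurable => // i _; rewrite -[X in measurable X]setTI.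
apply: mf => //.
have -> : [set r : R | `|r - ratr (q ord0 i)| < k.+1%:R^-1] =
    ball (ratr (q ord0 i) : R) k.+1%:R^-1.
  by apply/seteqP; split => r; rewrite /ball /= distrC.
exact: measurable_ball.
Qed.

Lemma measurable_rV_box n (B : 'I_n -> set R) :
  (forall i, measurable (B i)) ->
  measurable [set x : 'rV[R]_n | forall i, B i (x ord0 i)].
Proof.
move=> mB.
have -> : [set x : 'rV[R]_n | forall i, B i (x ord0 i)] =
    \bigcap_(i in setT) ((fun x : 'rV[R]_n => x ord0 i) @^-1` B i).
  by apply/seteqP; split => x /= Bx i //=; exact: Bx.
apply: fin_bigcap_measurable => // i _; rewrite -[X in measurable X]setTI.
exact: measurable_rV_coord.
Qed.

End borel_rV.

Section lebesgue_rV.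
Context {R : realType}.
Local Open Scope ereal_scope.

Definition rV_cons n (p : R * 'rV[R]_n) : 'rV[R]_n.+1 :=
  row_mx (p.1%:M : 'rV_1) p.2.

Definition rV_uncons n (x : 'rV[R]_n.+1) : R * 'rV[R]_n :=
  (x ord0 ord0, \row_i x ord0 (lift ord0 i)).

Lemma rV_cons0 n p : @rV_cons n p ord0 ord0 = p.1.
Proof.
rewrite /rV_cons mxE; case: splitP => [j _|j] //.
by rewrite !ord1 mxE.
Qed.

Lemma rV_consS n p i : @rV_cons n p ord0 (lift ord0 i) = p.2 ord0 i.
Proof.
rewrite /rV_cons mxE; case: splitP => [[[]]|j /= [ij]] //.
by congr (_ _ _); apply/val_inj; move: ij; rewrite !add0n.
Qed.

Lemma rV_consK n : cancel (@rV_cons n) (@rV_uncons n).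
Proof.
move=> [r x]; rewrite /rV_uncons rV_cons0; congr pair.
by apply/rowP => i; rewrite mxE rV_consS.
Qed.

Lemma measurable_rV_cons n : measurable_fun setT (@rV_cons n).
Proof.
apply: measurable_fun_rV => i; have [->|[j ->]] : i = ord0 \/ exists j, i = lift ord0 j.
  by case: (unliftP ord0 i) => [j ->|->]; [right; exists j|left].
  by under eq_fun do rewrite rV_cons0; exact: measurable_fst.
under eq_fun do rewrite rV_consS.
by apply: (measurableT_comp (measurable_rV_coord j)); exact: measurable_snd.
Qed.

Lemma measurable_rV_uncons n : measurable_fun setT (@rV_uncons n).
Proof.
apply: measurable_fun_pair; first exact: measurable_rV_coord.
apply: measurable_fun_rV => i; under eq_fun do rewrite mxE.
exact: measurable_rV_coord.
Qed.

Section cons_measure.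
Variables (n : nat) (mu : {sigma_finite_measure set 'rV[R]_n -> \bar R}).

Definition cons_measure : set 'rV[R]_n.+1 -> \bar R :=
  pushforward (lebesgue_measure \x mu) (@rV_cons n).

Let cons_measure0 : cons_measure set0 = 0.
Proof. by rewrite /cons_measure /pushforward preimage_set0 measure0. Qed.

Let cons_measure_ge0 A : 0 <= cons_measure A.
Proof. by apply: measure_ge0; exact: measurable_rV_cons. Qed.

Let cons_measure_sigma_additive : semi_sigma_additive cons_measure.
Proof.
by apply: measure_semi_sigma_additive; exact: measurable_rV_cons.
Qed.

HB.instance Definition _ := isMeasure.Build _ _ _ cons_measure
  cons_measure0 cons_measure_ge0 cons_measure_sigma_additive.

Let cons_measure_sigma_finite : sigma_finite setT cons_measure.
Proof.
have /sigma_finiteP[F [TF ndF Foo]] := sigma_finiteT (@lebesgue_measure R).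
have /sigma_finiteP[G [TG ndG Goo]] := sigma_finiteT mu.
exists (fun k => @rV_uncons n @^-1` (F k `*` G k)).
  rewrite -preimage_bigcup (_ : \bigcup_k _ = setT) ?preimage_setT//.
  apply/seteqP; split => // -[r x] _.
  have [k _ Fk] : (\bigcup_k F k) r by rewrite -TF.
  have [l _ Gl] : (\bigcup_k G k) x by rewrite -TG.
  exists (maxn k l) => //; split => /=.
    by move: r Fk; exact/subsetPset/ndF/leq_maxl.
  by move: x Gl; exact/subsetPset/ndG/leq_maxr.
move=> k; have [mFk Fk] := Foo k; have [mGk Gk] := Goo k.
have mFG : measurable (F k `*` G k) by exact: measurableX.
split; first by rewrite -[X in measurable X]setTI; exact: measurable_rV_uncons.
rewrite /cons_measure /pushforward (_ : _ @^-1` (_ @^-1` _) = F k `*` G k).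
  by rewrite product_measure1E// lte_mul_pinfty// ge0_fin_numE.
by apply/seteqP; split => p; rewrite /preimage /mkset rV_consK.
Qed.

HB.instance Definition _ := Measure_isSigmaFinite.Build _ _ _ cons_measure
  cons_measure_sigma_finite.

End cons_measure.

(* N-dimensional Lebesgue measure; see lebesgue_rV_box for its value on boxes. *)
Fixpoint lebesgue_rV (n : nat) : {sigma_finite_measure set 'rV[R]_n -> \bar R} :=
  match n return {sigma_finite_measure set 'rV[R]_n -> \bar R} with
  | 0%N => \d_(0%R : 'rV[R]_0)
  | n'.+1 => cons_measure (lebesgue_rV n')
  end.

Lemma lebesgue_rV_box n (B : 'I_n -> set R) :
  (forall i, measurable (B i)) ->
  lebesgue_rV n [set x | forall i, B i (x ord0 i)] =
  \prod_(i < n) lebesgue_measure (B i).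
Proof.
elim: n B => [|n IH] B mB; first by rewrite big_ord0 /= diracE mem_set// => -[].
rewrite big_ord_recl -IH// -product_measure1E//.
  congr (product_measure1 _ _ _); apply/seteqP; split => -[r x] /=.
    move=> Bx; split; first by have := Bx ord0; rewrite rV_cons0.
    by move=> i; have := Bx (lift ord0 i); rewrite rV_consS.
  move=> [Br Bx] i; case: (unliftP ord0 i) => [j ->|->].
    by rewrite rV_consS.
  by rewrite rV_cons0.
  exact: mB.
exact: measurable_rV_box (fun i => mB (lift ord0 i)).
Qed.

End lebesgue_rV.

Section multiindex.

(* Addition and 0 on multi-indices are the pointwise ones. *)
Definition multiindex (N : nat) := {ffun 'I_N -> nat}.

Definition mdegree N (j : multiindex N) : nat := (\sum_(i < N) j i)%N.

(* K N l is the number of multi-indices of degree l (for N > 0). *)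
Definition K (N l : nat) : nat := 'C((N + l - 1)%N, l).

Definition monomial_order N (le : rel (multiindex N)) : Prop :=
  [/\ total_order le, well_order le &
      forall a b c : multiindex N, le a b -> le (a + c) (b + c)].

(* jj l lists the multi-indices of degree l increasingly for le. *)
Record monomial_listing N (le : rel (multiindex N))
    (jj : forall l, 'I_(K N l) -> multiindex N) : Prop := {
  listing_degree : forall l i, mdegree (jj l i) = l ;
  listing_inj : forall l, injective (jj l) ;
  listing_surj : forall l j, mdegree j = l -> exists i, jj l i = j ;
  listing_sorted : forall l (i i' : 'I_(K N l)), (i <= i')%N ->
    le (jj l i) (jj l i') }.

End multiindex.

Section pce.
Context {R : realType}.

Definition monomial N (j : multiindex N) (x : 'rV[R]_N) : R :=
  \prod_(i < N) x ord0 i ^+ j i.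

Definition lin_span (T : Type) (S : set (T -> R)) : set (T -> R) :=
  [set g | exists n (c : 'I_n -> R) (s : 'I_n -> T -> R),
     (forall i, S (s i)) /\ forall t, g t = \sum_(i < n) c i * s i t].

Definition poly_space N (m : nat) : set ('rV[R]_N -> R) :=
  lin_span [set monomial j | j in [set j | (mdegree j <= m)%N]].

Definition is_norm N (nrm : 'rV[R]_N -> R) : Prop :=
  [/\ forall x, 0 <= nrm x,
      forall x, nrm x = 0 -> x = 0,
      forall (a : R) x, nrm (a *: x) = `|a| * nrm x &
      forall x y, nrm (x + y) <= nrm x + nrm y].

Definition mxRintegral d (T : measurableType d)
    (mu : {measure set T -> \bar R}) (D : set T) m n (F : T -> 'M[R]_(m, n)) :
    'M[R]_(m, n) :=
  \matrix_(i < m, j < n) \int[mu]_(t in D) F t i j.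

Definition mxexpectation d (Omega : measurableType d)
    (P : probability Omega R) m n (F : Omega -> 'M[R]_(m, n)) : 'M[R]_(m, n) :=
  mxRintegral P setT F.

(* f is the density of X, extended by 0 outside A; the support condition leaves
   open whether A contains its boundary. *)
Record input_assumption d (Omega : measurableType d) (P : probability Omega R)
    N (A : set 'rV[R]_N) (X : {RV P >-> 'rV[R]_N}) (f nrm : 'rV[R]_N -> R) :
    Prop := {
  input_domain : measurable A ;
  input_range : forall w, A (X w) ;
  density_ge0 : forall x, 0 <= f x ;
  density_support :
    [set x | f x != 0] `<=` A /\ A `<=` closure [set x | f x != 0] ;
  density_continuous : {within A, continuous f} ;
  density_distribution : forall B, measurable B ->
    distribution P X B = (\int[lebesgue_rV N]_(x in A `&` B) (f x)%:E)%E ;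
  input_moments : forall j : multiindex N,
    (\int[lebesgue_rV N]_(x in A) (`|monomial j x| * f x)%:E < +oo)%E ;
  input_tail :
    (exists2 C : set 'rV[R]_N, compact C & P (X @^-1` C) = 1%E) \/
    (exists2 alpha : R, 0 < alpha &
      (\int[lebesgue_rV N]_(x in A) (expR (alpha * nrm x) * f x)%:E < +oo)%E) }.

Section vectors.
Variables (N : nat) (jj : forall l, 'I_(K N l) -> multiindex N).

(* For a family Q indexed by multi-indices, the column Q_l. *)
Definition graded_col (Q : multiindex N -> 'rV[R]_N -> R) (l : nat)
    (x : 'rV[R]_N) : 'cV[R]_(K N l) :=
  \col_(i < K N l) Q (jj i) x.

Record orthogonal_polynomials (A : set 'rV[R]_N) (f : 'rV[R]_N -> R)
    (Q : multiindex N -> 'rV[R]_N -> R) : Prop := {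
  op_0 : forall x, Q 0 x = 1 ;
  op_degree : forall j, poly_space (mdegree j) (Q j) ;
  op_orthogonal : forall l r, (r < l)%N ->
    mxRintegral (lebesgue_rV N) A (fun x =>
      f x *: (graded_col (@monomial N) r x *m (graded_col Q l x)^T)) = 0 ;
  op_unit : forall l,
    mxRintegral (lebesgue_rV N) A (fun x =>
      f x *: (graded_col (@monomial N) l x *m (graded_col Q l x)^T))
    \in unitmx }.

Context d (Omega : measurableType d) (P : probability Omega R)
  (X : {RV P >-> 'rV[R]_N}) (Q : multiindex N -> 'rV[R]_N -> R)
  (W : forall l, 'M[R]_(K N l)).

Definition moment_matrix (l : nat) : 'M[R]_(K N l) :=
  mxexpectation P (fun w => graded_col Q l (X w) *m (graded_col Q l (X w))^T).

Record whitening : Prop := {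
  whitening_unit : forall l, W l \in unitmx ;
  whitening_inv : forall l, (W l)^T *m W l = invmx (moment_matrix l) ;
  whitening_0 : W 0 = 1%:M }.

Definition Psi (l : nat) (x : 'rV[R]_N) : 'cV[R]_(K N l) :=
  W l *m graded_col Q l x.

(* The span of the Psi_j(X) with |j| = l, these being the entries of Psi l. *)
Definition Psi_span (l : nat) : set (Omega -> R) :=
  lin_span [set (fun w => Psi l (X w) i ord0) | i in [set: 'I_(K N l)]].

(* The set underlying the internal direct sum of the Psi_span l, l <= m. *)
Definition Psi_dsum (m : nat) : set (Omega -> R) :=
  [set Z | exists z : 'I_m.+1 -> Omega -> R,
     (forall l : 'I_m.+1, Psi_span l (z l)) /\
     forall w, Z w = \sum_(l < m.+1) z l w].

Definition pce_coef (y : 'rV[R]_N -> R) (l : nat) : 'cV[R]_(K N l) :=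
  mxexpectation P (fun w => y (X w) *: Psi l (X w)).

Definition pce (y : 'rV[R]_N -> R) (m : nat) (x : 'rV[R]_N) : R :=
  \sum_(l < m.+1) ((pce_coef y l)^T *m Psi l x) ord0 ord0.

End vectors.

Definition L2_orthogonal d (Omega : measurableType d) (P : probability Omega R)
    (U V : Omega -> R) : Prop :=
  [/\ U \in Lfun P 2%:E, V \in Lfun P 2%:E &
      'E_P[fun w => (U w * V w)%R] = 0%E]%E.

End pce.

(* Main.v *)
Require Import Defs.
From HB Require Import structures.
From mathcomp Require Import all_boot all_order all_algebra finmap.
From mathcomp Require Import all_classical all_reals all_analysis.
From mathcomp Require Import measurable_realfun ring lra.
Import Order.TTheory GRing.Theory Num.Theory.
Import numFieldNormedType.Exports.
Set Implicit Arguments.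
Unset Strict Implicit.
Unset Printing Implicit Defensive.
Local Open Scope classical_set_scope.
Local Open Scope ring_scope.

(** Write Y = y(X).  The argument has an algebraic half and an analytic half.

    Algebra.  The truncation y_m(X) is the orthogonal projection of Y onto the
    span of the Psi_j(X) with |j| <= m.  Indeed Q_l is orthogonal to every
    polynomial of degree less than l ([Q_perp_lower]) and the whitening relation
    turns the Gram matrix of Psi_l into the identity ([whitening_moment]), so
    the Psi_j(X) are orthonormal ([psi_orthonormal]); subtracting the Fourier
    sum of Y leaves something orthogonal to each of them ([error_perp_psi]),
    which is the first claim.  That span contains all polynomials of degree at
    most m ([poly_space_Psi_upto]): if Q_l = C_l x_l + (lower degree), then the
    moment matrix is G_l = C_l S_l, so C_l is invertible and the monomials of
    degree l can be solved for.  By Pythagoras, E(Y - y_m(X))^2 is therefore at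
    most E(Y - p(X))^2 for every polynomial p of degree at most m
    ([sqdist_pce_le]), and the second claim reduces to the density of the
    polynomials in X among the square-integrable functions of X.

    Analysis ([polynomials_dense]).  Let V be the L^2 closure of the polynomials
    in X, and call a bounded function h a multiplier when h V is contained in V.
    Multipliers form an algebra that is closed under bounded pointwise limits
    ([multiplier_cvg]).  Exponential integrability enters at one point: for
    large k the Taylor sums of sin((X_i - a) / k) are dominated by
    exp(|X_i - a| / k), whose fourth power is integrable, so dominated
    convergence makes sin((X_i - a) / k) a multiplier ([multiplier_sin]).
    Iterating the cubic (3 x - x^3) / 2 extracts its sign, and letting k tend to
    infinity gives the sign of X_i - a ([multiplier_sgr_sub]), hence the
    indicator of {X_i > a}.  The Borel sets B for which the indicator of
    {X in B} is a multiplier form a sigma-algebra, so they are all the Borel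
    sets ([multiplier_borel]), and approximation by simple functions puts every
    square-integrable function of X in V ([l2_closure_borel]). *)

(** * Square-integrable functions *)

Section L2_space.
Context d (T : measurableType d) (R : realType) (P : probability T R).
Implicit Types U V G h : T -> R.

Definition L2 : set (T -> R) := [set U | U \in Lfun P 2%:E].

(** The form in which membership is proved: the exponent 2 of the real power in
    the Lebesgue norm becomes an ordinary square. *)
Lemma L2P U : L2 U <->
  measurable_fun setT U /\ P.-integrable setT (EFin \o (fun t => U t ^+ 2)).
Proof.
split=> [U2|[mU iU]].
  split; last exact: Lfun2_integrable_sqr.
  by move: U2; rewrite /L2 /= inE => /andP[/[!inE]/= mU _].
rewrite /L2 /=; rewrite inE; apply/andP; split; rewrite inE//=.
rewrite /finite_norm unlock poweR_lty//.
have /integrableP[_] := iU; apply: le_lt_trans.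
rewrite le_eqVlt; apply/orP; left; apply/eqP; apply: eq_integral => t _ /=.
by rewrite powR_mulrn// normrX.
Qed.

Lemma L2_measurable U : L2 U -> measurable_fun setT U.
Proof. by move=> /L2P[]. Qed.

Lemma L2_dominated U G : measurable_fun setT U -> L2 G ->
  (forall t, `|U t| <= `|G t|) -> L2 U.
Proof.
move=> mU /L2P[mG iG] UG; apply/L2P; split => //.
apply: le_integrable iG => //.
  by apply/measurable_EFinP; exact: measurable_funX.
by move=> t _ /=; rewrite lee_fin !normrX lerXn2r// nnegrE.
Qed.

Lemma L2D U V : L2 U -> L2 V -> L2 (fun t => U t + V t).
Proof.
by move=> U2 V2; rewrite /L2 /= -[X in X \in _]/(U + V) rpredD ?lee1n.
Qed.

Lemma L2B U V : L2 U -> L2 V -> L2 (fun t => U t - V t).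
Proof.
by move=> U2 V2; rewrite /L2 /= -[X in X \in _]/(U - V) rpredB ?lee1n.
Qed.

Lemma L2_cst c : L2 (fun=> c).
Proof. exact: Lfun_cst. Qed.

Lemma L2_bounded_mul h U (M : R) : measurable_fun setT h ->
  (forall t, `|h t| <= M) -> L2 U -> L2 (fun t => h t * U t).
Proof.
move=> mh hM U2; have /L2P[mU iU] := U2; apply/L2P; split.
  exact: measurable_funM.
have : P.-integrable setT (fun t => ((M ^+ 2)%:E * (U t ^+ 2)%:E)%E).
  exact: integrableZl.
apply: le_integrable => //.
  by apply/measurable_EFinP; apply: measurable_funX; exact: measurable_funM.
move=> t _ /=; rewrite lee_fin ger0_norm ?sqr_ge0//.
rewrite -exprMn [leRHS]ger0_norm ?sqr_ge0// !exprMn ler_wpM2r ?sqr_ge0//.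
by rewrite -real_normK ?num_real// lerXn2r// nnegrE// (le_trans _ (hM t)).
Qed.

Lemma L2Z c U : L2 U -> L2 (fun t => c * U t).
Proof. by apply: (@L2_bounded_mul (fun=> c) U `|c|). Qed.

Lemma L2_sum (I : Type) (r : seq I) (p : pred I) (F : I -> T -> R) :
  (forall i, p i -> L2 (F i)) -> L2 (fun t => \sum_(i <- r | p i) F i t).
Proof.
move=> F2; elim: r => [|i r ih].
  have -> : (fun t => \sum_(i <- [::] | p i) F i t) = fun=> 0.
    by apply/funext => t; rewrite big_nil.
  exact: L2_cst.
have -> : (fun t => \sum_(j <- i :: r | p j) F j t) =
    fun t => (if p i then F i t else 0) + \sum_(j <- r | p j) F j t.
  by apply/funext => t; rewrite big_cons; case: ifP; rewrite ?add0r.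
by apply: L2D => //; case pi: (p i); [exact: F2|exact: L2_cst].
Qed.

Lemma L2_integrableM U V : L2 U -> L2 V ->
  P.-integrable setT (EFin \o (fun t => U t * V t)).
Proof. by move=> U2 V2; apply/Lfun1_integrable; exact: Lfun2_mul_Lfun1. Qed.

Definition ip U V : R := \int[P]_t (U t * V t).

Lemma ipC U V : ip U V = ip V U.
Proof. by rewrite /ip; apply: eq_Rintegral => t _; rewrite mulrC. Qed.

Lemma ipDl U V G : L2 U -> L2 V -> L2 G ->
  ip (fun t => U t + V t) G = ip U G + ip V G.
Proof.
move=> U2 V2 G2; rewrite /ip -RintegralD//; try exact: L2_integrableM.
by apply: eq_Rintegral => t _; rewrite mulrDl.
Qed.

Lemma ipZl c U G : L2 U -> L2 G -> ip (fun t => c * U t) G = c * ip U G.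
Proof.
move=> U2 G2; rewrite /ip -RintegralZl//; last exact: L2_integrableM.
by apply: eq_Rintegral => t _; rewrite mulrA.
Qed.

Lemma ipBl U V G : L2 U -> L2 V -> L2 G ->
  ip (fun t => U t - V t) G = ip U G - ip V G.
Proof.
move=> U2 V2 G2; rewrite /ip -RintegralB//; try exact: L2_integrableM.
by apply: eq_Rintegral => t _; rewrite mulrBl.
Qed.

Lemma ip_suml n (F : 'I_n -> T -> R) G :
  (forall i, L2 (F i)) -> L2 G ->
  ip (fun t => \sum_(i < n) F i t) G = \sum_(i < n) ip (F i) G.
Proof.
move=> F2 G2; elim: n F F2 => [|n ih] F F2.
  rewrite big_ord0 -[RHS](mul0r (ip G G)) -ipZl//.
  by congr (ip _ G); apply/funext => t; rewrite big_ord0 mul0r.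
rewrite big_ord_recr /= -ih// -ipDl//; last exact: L2_sum.
by congr (ip _ G); apply/funext => t; rewrite big_ord_recr.
Qed.

Definition sqdist U V : R := \int[P]_t (U t - V t) ^+ 2.

Lemma sqdistE U V : sqdist U V = ip (fun t => U t - V t) (fun t => U t - V t).
Proof. by apply: eq_Rintegral => t _; rewrite expr2. Qed.

Lemma sqdist_ge0 U V : 0 <= sqdist U V.
Proof. by apply: Rintegral_ge0 => t _; exact: sqr_ge0. Qed.

Lemma sqdist_integrable U V : L2 U -> L2 V ->
  P.-integrable setT (EFin \o (fun t => (U t - V t) ^+ 2)).
Proof. by move=> U2 V2; have /L2P[] := L2B U2 V2. Qed.

(** The constant 2 comes from (a + b)^2 <= 2 a^2 + 2 b^2; working with squared
    distances avoids square roots. *)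
Lemma sqdist_triangle V U G : L2 U -> L2 V -> L2 G ->
  sqdist U G <= 2 * sqdist U V + 2 * sqdist V G.
Proof.
move=> U2 V2 G2.
have h (c : R) A B : L2 A -> L2 B -> P.-integrable setT
    (EFin \o (fun t => c * (A t - B t) ^+ 2)).
  move=> A2 B2; rewrite (_ : _ \o _ =
    fun t => (c%:E * ((A t - B t) ^+ 2)%:E)%E)//.
  by apply: integrableZl => //; exact: sqdist_integrable.
rewrite /sqdist -!RintegralZl//; try exact: sqdist_integrable.
rewrite -RintegralD//; try exact: h.
apply: le_Rintegral => //; first exact: sqdist_integrable.
  rewrite (_ : _ \o _ = fun t => ((2 * (U t - V t) ^+ 2)%:E +
    (2 * (V t - G t) ^+ 2)%:E)%E)//.
  by apply: integrableD => //; exact: h.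
move=> t _; have := sqr_ge0 ((U t - V t) - (V t - G t)); nra.
Qed.

Lemma sqdist_bounded_mul h U V (M : R) : measurable_fun setT h ->
  (forall t, `|h t| <= M) -> L2 U -> L2 V ->
  sqdist (fun t => h t * U t) (fun t => h t * V t) <= M ^+ 2 * sqdist U V.
Proof.
move=> mh hM U2 V2; rewrite /sqdist -RintegralZl//; last exact: sqdist_integrable.
apply: le_Rintegral => //.
- by apply: sqdist_integrable; exact: L2_bounded_mul hM _.
- rewrite (_ : _ \o _ = fun t => ((M ^+ 2)%:E * ((U t - V t) ^+ 2)%:E)%E)//.
  by apply: integrableZl => //; exact: sqdist_integrable.
- move=> t _; rewrite -mulrBr exprMn ler_wpM2r ?sqr_ge0//.
  by rewrite -real_normK ?num_real// lerXn2r// nnegrE// (le_trans _ (hM t)).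
Qed.

(** The squared differences are at most 4 G^2, which is integrable, so the
    classical dominated convergence theorem applies to them. *)
Lemma L2_dominated_cvg (F : nat -> T -> R) U G :
  (forall n, measurable_fun setT (F n)) -> L2 G ->
  (forall n t, `|F n t| <= `|G t|) ->
  (forall t, F ^~ t @ \oo --> U t) ->
  L2 U /\ sqdist U (F n) @[n --> \oo] --> 0.
Proof.
move=> mF G2 FG FU.
have mU : measurable_fun setT U.
  exact: (@measurable_fun_cvg _ _ _ _ F).
have UG t : `|U t| <= `|G t|.
  have cU : `|F n t| @[n --> \oo] --> `|U t| by apply: cvg_norm.
  rewrite -(cvg_lim _ cU)//; apply: limr_le; first by apply/cvg_ex; exists `|U t|.
  by apply: nearW => n; exact: FG.
have U2 : L2 U by exact: (L2_dominated mU G2).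
have F2 n : L2 (F n) by exact: (L2_dominated (mF n) G2).
split => //.
have iG : P.-integrable setT (fun t => (4%:E * (G t ^+ 2)%:E)%E).
  by apply: integrableZl => //; have /L2P[] := G2.
have := @dominated_cvg _ T R P setT measurableT
  (fun n t => ((U t - F n t) ^+ 2)%:E) (cst 0%E) _ _ _ _ iG.
rewrite integral0 => h.
have : fine (\int[P]_t ((U t - F n t) ^+ 2)%:E)%E @[n --> \oo] --> fine 0%E.
  apply: fine_cvg; apply: h => //.
  - move=> n; apply/measurable_EFinP; apply: measurable_funX.
    by apply: measurable_funB.
  - move=> t _; apply: cvg_EFin; first exact: nearW.
    rewrite (_ : _ \o _ = fun n => (U t - F n t) ^+ 2)//.
    rewrite [X in _ --> X](_ : _ = (U t - U t) * (U t - U t)); last first.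
      by rewrite subrr mulr0.
    by under eq_fun do rewrite expr2; apply: cvgM; apply: cvgB => //; exact: cvg_cst.
  - move=> n t _; rewrite /= lee_fin ger0_norm ?sqr_ge0//.
    rewrite -[X in X <= _](real_normK (num_real _)) -[X in _ <= _ * X](real_normK (num_real _)).
    have -> : 4 * `|G t| ^+ 2 = (2 * `|G t|) ^+ 2 by rewrite exprMn -natrX.
    rewrite lerXn2r ?nnegrE ?mulr_ge0//.
    by rewrite (le_trans (ler_normB _ _))// mulr_natl mulr2n lerD.
by [].
Qed.

End L2_space.

(** * Real sequences: the sign as a limit of polynomials, and the sine *)

Section real_sequences.
Context {R : realType}.
Implicit Types x y : R.

(** The odd cubic with fixed points -1, 0 and 1, of which 0 is repelling and
    the other two are attracting: its iterates turn any element of an algebra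
    with values in [-1, 1] into its sign. *)
Definition sgn_step x : R := (3 * x - x ^+ 3) / 2.

Lemma sgn_step_le1 x : `|x| <= 1 -> `|sgn_step x| <= 1.
Proof.
rewrite !ler_norml /sgn_step => /andP[x0 x1]; apply/andP; split.
  rewrite -subr_ge0 (_ : _ - _ = (1 + x) ^+ 2 * (2 - x) / 2); last by field.
  by rewrite divr_ge0// mulr_ge0 ?sqr_ge0//; lra.
rewrite -subr_ge0 (_ : _ - _ = (1 - x) ^+ 2 * (2 + x) / 2); last by field.
by rewrite divr_ge0// mulr_ge0 ?sqr_ge0//; lra.
Qed.

(** With y the current iterate, 1 - sgn_step y = (1 - y)^2 (2 + y) / 2, which
    is at most (1 - y) (1 - y / 2); as the iterates only increase, the
    contraction factor is at most 1 - x / 2. *)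
Lemma sgn_step_gt0 x n : 0 < x -> x <= 1 ->
  [/\ x <= iter n sgn_step x, iter n sgn_step x <= 1 &
      1 - iter n sgn_step x <= (1 - x / 2) ^+ n].
Proof.
move=> x0 x1; elim: n => [|n [xy y1 IH]]; first by split => //=; lra.
set y := iter n sgn_step x in xy y1 IH *; rewrite iterS -/y.
have y0 : 0 < y by exact: lt_le_trans xy.
have sy1 : sgn_step y <= 1.
  by have := @sgn_step_le1 y; rewrite !ler_norml => /(_ _)/andP[]//; lra.
split => //.
  rewrite (le_trans xy)// -subr_ge0.
  rewrite (_ : _ - _ = y * ((1 - y) * (1 + y)) / 2); last by rewrite /sgn_step; field.
  by rewrite divr_ge0// mulr_ge0// ?mulr_ge0//; lra.
have -> : 1 - sgn_step y = (1 - y) * ((1 - y) * (2 + y) / 2).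
  by rewrite /sgn_step; field.
rewrite exprSr ler_pM//; [by lra| |].
  by rewrite divr_ge0// mulr_ge0//; lra.
have := sqr_ge0 y; nra.
Qed.

Lemma cvg_sgn_step x : `|x| <= 1 -> iter n sgn_step x @[n --> \oo] --> Num.sg x.
Proof.
have pos y : 0 < y -> y <= 1 -> iter n sgn_step y @[n --> \oo] --> (1 : R).
  move=> y0 y1; apply/cvgrPdist_le => e e0.
  have /cvgrPdist_le/(_ e e0) : (1 - y / 2) ^+ n @[n --> \oo] --> (0 : R).
    by apply: cvg_expr; rewrite ger0_norm; lra.
  apply: filterS => n; rewrite sub0r normrN => h.
  have [_ le1 le2] := sgn_step_gt0 n y0 y1.
  rewrite ger0_norm ?subr_ge0//; apply: (le_trans le2).
  by rewrite (le_trans (ler_norm _) h).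
rewrite ler_norml => /andP[xN1 x1].
have [x0|x0|x0] := ltgtP x 0.
- rewrite ltr0_sg// (_ : (fun n => iter n sgn_step x) =
    fun n => - iter n sgn_step (- x)).
    by apply: cvgN; apply: pos; lra.
  apply/funext; elim=> [|n /= ->]; rewrite ?opprK// /sgn_step.
  by field.
- by rewrite gtr0_sg//; exact: pos.
- rewrite x0 sgr0 (_ : (fun n => iter n sgn_step 0) = fun=> 0); first exact: cvg_cst.
  apply/funext; elim=> [//|n /= ->]; rewrite /sgn_step.
  by rewrite expr0n !mulr0 subrr mul0r.
Qed.

Lemma series_sin_coeff_le x n : `|series (sin_coeff x) n| <= expR `|x|.
Proof.
apply: (@le_trans _ _ (series (exp_coeff `|x|) n)); last first.
  apply: nondecreasing_cvgn_le; last exact: is_cvg_series_exp_coeff.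
  by apply: nondecreasing_series => k _ _; exact: exp_coeff_ge0.
rewrite /series /= (le_trans (ler_norm_sum _ _ _))// ler_sum// => i _.
rewrite /exp_coeff /sin_coeff /= !normrM normfV !normr_nat !normrX normrN.
rewrite normr1 expr1n mulr1.
by case: odd; rewrite ?mul1r// mul0r mul0r divr_ge0// exprn_ge0.
Qed.

Lemma cvg_series_sin_coeff x : series (sin_coeff x) n @[n --> \oo] --> sin x.
Proof. by rewrite unlock; exact: is_cvg_series_sin_coeff. Qed.

(** Once n exceeds |x| the argument of the sine lies strictly between -pi and
    pi, where the sine has the sign of its argument. *)
Lemma cvg_sgr_sin x k :
  Num.sg (sin (x / (k + n).+1%:R)) @[n --> \oo] --> Num.sg x.
Proof.
apply: cvg_near_cst.
have [N xN] : exists N : nat, `|x| < N%:R.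
  exists (Num.truncn `|x|).+1; exact: truncnS_gt.
exists N => // n /= Nn.
have k0 : 0 < (k + n).+1%:R :> R by rewrite ltr0n.
have xk : `|x / (k + n).+1%:R| < pi.
  rewrite normrM normfV [X in _ / X]ger0_norm// ltr_pdivrMr//.
  rewrite (lt_le_trans xN)// (@le_trans _ _ ((k + n).+1%:R))//.
    by rewrite ler_nat (leq_trans Nn)// ltnW// ltnS leq_addl.
  by rewrite ler_peMl// (le_trans _ (pi_ge2 _))//; lra.
move: xk; rewrite ltr_norml => /andP[xk1 xk2].
have [x0|x0|x0] := ltgtP x 0.
- rewrite [RHS]ltr0_sg// ltr0_sg// -oppr_gt0 -sinN sin_gt0_pi//.
  rewrite oppr_gt0 ltrNl xk1 andbT.
  by rewrite pmulr_llt0// invr_gt0.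
- by rewrite [RHS]gtr0_sg// gtr0_sg// sin_gt0_pi// xk2 divr_gt0.
- by rewrite x0 mul0r sin0.
Qed.

End real_sequences.


(** * Closure of an algebra in L^2 and its multipliers *)

(** Closure under products is what makes all moments finite: the square of an
    element, and hence its fourth power, is again integrable. *)
Record L2_algebra d (T : measurableType d) (R : realType)
    (P : probability T R) (C : set (T -> R)) : Prop := {
  alg_L2 : C `<=` L2 P ;
  alg_cst : forall c, C (fun=> c) ;
  algD : forall p q, C p -> C q -> C (fun t => p t + q t) ;
  algM : forall p q, C p -> C q -> C (fun t => p t * q t) }.

Section l2_closure.
Context d (T : measurableType d) (R : realType) (P : probability T R).
Context (C : set (T -> R)) (CA : L2_algebra P C).
Let C_L2 := alg_L2 CA.
Implicit Types U V G h p q : T -> R.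

Definition l2_closure : set (T -> R) := [set U | L2 P U /\
  forall e : R, 0 < e -> exists2 p, C p & sqdist P U p < e].

Lemma l2_closure_L2 U : l2_closure U -> L2 P U.
Proof. by case. Qed.

Lemma sub_l2_closure : C `<=` l2_closure.
Proof.
move=> p Cp; split; first exact: C_L2.
move=> e e0; exists p => //; rewrite /sqdist.
under eq_Rintegral do rewrite subrr expr0n.
by rewrite Rintegral_cst// mul0r.
Qed.

Lemma l2_closure_near U : L2 P U ->
  (forall e : R, 0 < e -> exists2 V, l2_closure V & sqdist P U V < e) ->
  l2_closure U.
Proof.
move=> U2 UV; split => // e e0.
have e4 : 0 < e / 4 by rewrite divr_gt0.
have [V [V2 Vp] UVe] := UV _ e4; have [p Cp Vpe] := Vp _ e4.
exists p => //; apply: le_lt_trans (sqdist_triangle U2 V2 (C_L2 Cp)) _; lra.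
Qed.

Lemma l2_closure_dominated (F : nat -> T -> R) U G :
  (forall n, l2_closure (F n)) -> L2 P G ->
  (forall n t, `|F n t| <= `|G t|) ->
  (forall t, F ^~ t @ \oo --> U t) -> l2_closure U.
Proof.
move=> CF G2 FG FU.
have mF n : measurable_fun setT (F n) by apply: L2_measurable; exact: l2_closure_L2.
have [U2 d0] := L2_dominated_cvg mF G2 FG FU.
apply: l2_closure_near => // e e0.
have /cvgrPdist_lt/(_ e e0)[N _ /(_ N (leqnn N)) /= h] := d0.
exists (F N) => //.
by move: h; rewrite sub0r normrN ger0_norm ?sqdist_ge0.
Qed.

Lemma l2_closureD U V : l2_closure U -> l2_closure V ->
  l2_closure (fun t => U t + V t).
Proof.
move=> [U2 Up] [V2 Vp]; split; first exact: L2D.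
move=> e e0; have e8 : 0 < e / 8 by rewrite divr_gt0.
have [p Cp pe] := Up _ e8; have [q Cq qe] := Vp _ e8.
exists (fun t => p t + q t); first exact: (algD CA).
have pL := C_L2 Cp; have qL := C_L2 Cq.
apply: le_lt_trans (sqdist_triangle (L2D U2 V2) (L2D pL V2) (L2D pL qL)) _.
have -> : sqdist P (fun t => U t + V t) (fun t => p t + V t) = sqdist P U p.
  by apply: eq_Rintegral => t _; congr (_ ^+ 2); ring.
have -> : sqdist P (fun t => p t + V t) (fun t => p t + q t) = sqdist P V q.
  by apply: eq_Rintegral => t _; congr (_ ^+ 2); ring.
lra.
Qed.

(** Multiplication by a bounded function is continuous in mean square, so it is
    enough to test it on the algebra itself. *)
Lemma l2_closure_bounded_mul h (M : R) :
  measurable_fun setT h -> (forall t, `|h t| <= M) ->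
  (forall p, C p -> l2_closure (fun t => h t * p t)) ->
  forall U, l2_closure U -> l2_closure (fun t => h t * U t).
Proof.
move=> mh hM hC U [U2 Up]; apply: l2_closure_near.
  exact: L2_bounded_mul hM U2.
move=> e e0; have M0 : 0 < M ^+ 2 + 1 by rewrite ltr_wpDl ?sqr_ge0.
have [p Cp pe] := Up _ (divr_gt0 e0 M0).
exists (fun t => h t * p t); first exact: hC.
apply: le_lt_trans (sqdist_bounded_mul mh hM U2 (C_L2 Cp)) _.
rewrite (@le_lt_trans _ _ ((M ^+ 2 + 1) * sqdist P U p))//.
  by rewrite ler_wpM2r ?sqdist_ge0// lerDl.
by rewrite mulrC -ltr_pdivlMr.
Qed.

(** Square-integrable functions are not closed under products.  Multipliers are,
    and they still form a vector space closed under bounded pointwise limits: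
    a monotone-class argument needs both. *)
Definition multiplier h := [/\ measurable_fun setT h,
  exists M : R, forall t, `|h t| <= M &
  forall U, l2_closure U -> l2_closure (fun t => h t * U t)].

Lemma multiplier_l2_closure h : multiplier h -> l2_closure h.
Proof.
move=> [_ _ hC]; rewrite (_ : h = fun t => h t * 1); last first.
  by apply/funext => t; rewrite mulr1.
by apply: hC; apply: sub_l2_closure; exact: (alg_cst CA).
Qed.

Lemma multiplier_cst c : multiplier (fun=> c).
Proof.
split => //; first by exists `|c|.
apply: (@l2_closure_bounded_mul _ `|c|) => // p Cp.
by apply: sub_l2_closure; apply: (algM CA) => //; exact: (alg_cst CA).
Qed.

Lemma multiplierM h1 h2 : multiplier h1 -> multiplier h2 ->
  multiplier (fun t => h1 t * h2 t).
Proof.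
move=> [m1 [M1 hM1] C1] [m2 [M2 hM2] C2]; split.
- exact: measurable_funM.
- by exists (M1 * M2) => t; rewrite normrM ler_pM.
- move=> U /C2/C1; rewrite (_ : (fun t => h1 t * (h2 t * U t)) =
    fun t => h1 t * h2 t * U t)//.
  by apply/funext => t; rewrite mulrA.
Qed.

Lemma multiplierD h1 h2 : multiplier h1 -> multiplier h2 ->
  multiplier (fun t => h1 t + h2 t).
Proof.
move=> [m1 [M1 hM1] C1] [m2 [M2 hM2] C2]; split.
- exact: measurable_funD.
- by exists (M1 + M2) => t; rewrite (le_trans (ler_normD _ _))// lerD.
- move=> U CU; have := l2_closureD (C1 _ CU) (C2 _ CU).
  rewrite (_ : (fun t => h1 t * U t + h2 t * U t) =
    fun t => (h1 t + h2 t) * U t)//.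
  by apply/funext => t; rewrite mulrDl.
Qed.

Lemma multiplierB h1 h2 : multiplier h1 -> multiplier h2 ->
  multiplier (fun t => h1 t - h2 t).
Proof.
move=> H1 H2; have := multiplierD H1 (multiplierM (multiplier_cst (-1)) H2).
rewrite (_ : (fun t => h1 t + -1 * h2 t) = fun t => h1 t - h2 t)//.
by apply/funext => t; rewrite mulN1r.
Qed.

(** For U in the closure, the products F n * U are dominated by M * |U|. *)
Lemma multiplier_cvg (F : nat -> T -> R) h (M : R) :
  (forall n, multiplier (F n)) -> (forall n t, `|F n t| <= M) ->
  (forall t, F ^~ t @ \oo --> h t) -> multiplier h.
Proof.
move=> mF FM Fh; split.
- by apply: (@measurable_fun_cvg _ _ _ _ F) => // n; have [] := mF n.
- exists M => t.
  have ch : `|F n t| @[n --> \oo] --> `|h t| by exact: cvg_norm.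
  rewrite -(cvg_lim _ ch)//; apply: limr_le; first by apply/cvg_ex; exists `|h t|.
  by apply: nearW => n; exact: FM.
- move=> U CU.
  apply: (@l2_closure_dominated (fun n t => F n t * U t) _ (fun t => M * U t)).
  + by move=> n; have [_ _] := mF n; apply.
  + by apply: L2Z; exact: l2_closure_L2.
  + by move=> n t; rewrite !normrM ler_wpM2r// (le_trans (FM n t))// ler_norm.
  + by move=> t; apply: cvgMl.
Qed.

Lemma multiplier_sgr h : multiplier h -> (forall t, `|h t| <= 1) ->
  multiplier (fun t => Num.sg (h t)).
Proof.
move=> mh h1.
have iter1 n t : `|iter n sgn_step (h t)| <= 1.
  by elim: n => [|n ih] //=; exact: sgn_step_le1.
apply: (@multiplier_cvg (fun n t => iter n sgn_step (h t)) _ 1) => //.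
  elim=> [//|n ih] /=.
  have := multiplierB (multiplierM (multiplier_cst (3 / 2)) ih)
    (multiplierM (multiplier_cst 2^-1) (multiplierM ih (multiplierM ih ih))).
  congr multiplier; apply/funext => t; rewrite /sgn_step.
  by field.
by move=> t; exact: cvg_sgn_step.
Qed.

End l2_closure.

(** * Density of algebras with exponential tails *)

Section exponential_tail.
Context d (T : measurableType d) (R : realType) (P : probability T R).
Context (C : set (T -> R)) (CA : L2_algebra P C).
Variables (x : T -> R) (alpha : R).
Hypotheses (Cx : C x) (alpha0 : 0 < alpha).
Hypothesis exp_x :
  P.-integrable setT (EFin \o (fun t => expR (alpha * `|x t|))).

Lemma alg_poly (c : nat -> R) n p : C p ->
  C (fun t => \sum_(0 <= i < n) c i * p t ^+ i).
Proof.
move=> Cp; have CX i : C (fun t => p t ^+ i).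
  elim: i => [|i ih]; first exact: (alg_cst CA 1).
  by under eq_fun do rewrite exprS; exact: (algM CA).
elim: n => [|n ih].
  rewrite (_ : (fun t => _) = fun=> 0); first exact: (alg_cst CA).
  by apply/funext => t; rewrite big_nil.
under eq_fun do rewrite big_nat_recr//=.
by apply: (algD CA) => //; apply: (algM CA) => //; exact: (alg_cst CA).
Qed.

(** The dominating function of the Taylor sums in [multiplier_sin].  With E the
    exponential, (p E)^2 <= p^4 + E^4; p^4 is integrable because p^2 lies in the
    algebra, and E^4 <= exp(4 |a| / k) exp(alpha |x|) as soon as
    4 <= alpha k. *)
Lemma L2_mul_exp p a k : C p -> 4 <= alpha * k ->
  L2 P (fun t => p t * expR `|(x t - a) / k|).
Proof.
move=> Cp k4; have k0 : 0 < k by rewrite -(pmulr_rgt0 _ alpha0); lra.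
have mp := L2_measurable (alg_L2 CA Cp).
have mx := L2_measurable (alg_L2 CA Cx).
apply/L2P; split.
  apply: measurable_funM => //; apply: measurableT_comp => //.
  apply: measurableT_comp => //; apply: measurable_funM => //.
  exact: measurable_funB.
have /L2P[_ ip4] := alg_L2 CA (algM CA Cp Cp).
have : P.-integrable setT (fun t => (((p t * p t) ^+ 2)%:E +
    (expR (4 * `|a| / k))%:E * (expR (alpha * `|x t|))%:E)%E).
  by apply: integrableD => //; exact: integrableZl.
apply: le_integrable => //.
  apply/measurable_EFinP; apply: measurable_funX; apply: measurable_funM => //.
  apply: measurableT_comp => //; apply: measurableT_comp => //.
  by apply: measurable_funM => //; exact: measurable_funB.
move=> t _; rewrite -EFinM -EFinD /= lee_fin.
rewrite ger0_norm ?sqr_ge0// [leRHS]ger0_norm ?addr_ge0 ?sqr_ge0 ?mulr_ge0 ?expR_ge0//.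
rewrite -expRD.
set E := expR `|_|.
have E4 : E ^+ 4 <= expR (4 * `|a| / k + alpha * `|x t|).
  rewrite -expRM_natl ler_expR normrM normfV (gtr0_norm k0).
  have h : `|x t - a| <= `|x t| + `|a| by exact: ler_normB.
  have k1 : 4 * k^-1 <= alpha by rewrite ler_pdivrMr.
  have i0 : 0 <= k^-1 by rewrite invr_ge0 ltW.
  have h1 := ler_wpM2r i0 h; have h2 := ler_wpM2r (normr_ge0 (x t)) k1.
  lra.
have := sqr_ge0 (p t ^+ 2 - E ^+ 2); have := sqr_ge0 (p t ^+ 2).
have := sqr_ge0 (E ^+ 2); lra.
Qed.

(** The Taylor sums are polynomials in x, so their products with elements of
    the algebra stay in the algebra. *)
Lemma multiplier_sin a k : 4 <= alpha * k ->
  multiplier P C (fun t => sin ((x t - a) / k)).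
Proof.
move=> k4; have mx := L2_measurable (alg_L2 CA Cx).
have sin1 t : `|sin ((x t - a) / k)| <= 1 by exact: sin_max.
have msin : measurable_fun setT (fun t => sin ((x t - a) / k)).
  apply: measurableT_comp; last first.
    by apply: measurable_funM => //; exact: measurable_funB.
  by apply: continuous_measurable_fun; exact: continuous_sin.
split => //; first by exists 1.
apply: (l2_closure_bounded_mul CA msin sin1) => p Cp.
apply: (l2_closure_dominated CA
  (F := fun n t => series (sin_coeff ((x t - a) / k)) n * p t) _
  (L2_mul_exp a Cp k4)).
- move=> n; apply: (sub_l2_closure CA); apply: (algM CA) => //.
  have Cy : C (fun t => (x t - a) / k).
    by apply: (algM CA); [apply: (algD CA) => //|]; exact: (alg_cst CA).
  under eq_fun do rewrite sin_coeffE.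
  exact: (alg_poly (fun i => (odd i)%:R * (-1) ^+ i.-1./2 * i`!%:R^-1) n Cy).
- move=> n t; rewrite [leLHS]normrM [leRHS]normrM mulrC ler_wpM2l//.
  by rewrite [leRHS]ger0_norm ?expR_ge0//; exact: series_sin_coeff_le.
- by move=> t; apply: cvgMr_tmp; exact: cvg_series_sin_coeff.
Qed.

Lemma multiplier_sgr_sub a : multiplier P C (fun t => Num.sg (x t - a)).
Proof.
(* from this k on, the condition 4 <= alpha * k of multiplier_sin holds *)
pose k := Num.truncn (4 / alpha).
apply: (multiplier_cvg CA (M := 1)
  (F := fun n t => Num.sg (sin ((x t - a) / (k + n).+1%:R)))).
- move=> n; apply: (multiplier_sgr CA); last by move=> t; exact: sin_max.
  apply: multiplier_sin; rewrite mulrC -ler_pdivrMr//.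
  rewrite (le_trans (ltW (truncnS_gt _)))// ler_nat ltnS leq_addr//.
- by move=> n t; rewrite normr_sg; case: (_ != 0).
- by move=> t; exact: cvg_sgr_sin.
Qed.

(** The indicator of s > 0 is (sgn s + (sgn s)^2) / 2. *)
Lemma multiplier_gt a : multiplier P C (fun t => \1_[set s | a < x s] t).
Proof.
have h := multiplier_sgr_sub a.
have := multiplierM (multiplier_cst CA 2^-1) (multiplierD CA h (multiplierM h h)).
congr multiplier; apply/funext => t; rewrite indicE mem_setE -[t \in _]/(a < x t).
have [xa|xa|->] := ltgtP a (x t) => /=.
- by rewrite gtr0_sg ?subr_gt0//; lra.
- by rewrite ltr0_sg ?subr_lt0//; lra.
- by rewrite subrr sgr0; lra.
Qed.

End exponential_tail.

Section borel_density.
Import HBNNSimple.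
Context d (T : measurableType d) (R : realType) (P : probability T R).
Context (C : set (T -> R)) (CA : L2_algebra P C).
Variables (N : nat) (X : T -> 'rV[R]_N).
Hypothesis multiplier_coord_gt : forall i a,
  multiplier P C (fun t => \1_[set s | a < X s ord0 i] t).

(** The sets whose indicator is a multiplier form a sigma-algebra S: finite
    unions come from the algebra structure, countable ones from bounded
    limits.  That S contains the Borel sets says that the identity is
    measurable from S to the Borel sigma-algebra, and this can be checked on
    coordinates. *)
Lemma multiplier_borel (B : set 'rV[R]_N) : measurable B ->
  multiplier P C (fun t => \1_B (X t)).
Proof.
pose S : set (set 'rV[R]_N) := [set B | multiplier P C (fun t => \1_B (X t))].
have SU A B' : S A -> S B' -> S (A `|` B').
  move=> SA SB; have := multiplierB CA (multiplierD CA SA SB) (multiplierM SA SB).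
  rewrite /S /=; congr multiplier; apply/funext => t; rewrite !indicE in_setU.
  by case: (_ \in A); case: (_ \in B') => /=; ring.
have SS : sigma_algebra setT S.
  split.
  - rewrite /S /=; have := multiplier_cst CA 0; congr multiplier.
    by apply/funext => t; rewrite indic0.
  - move=> A SA; rewrite setTD /S /=.
    have := multiplierB CA (multiplier_cst CA 1) SA.
    congr multiplier; apply/funext => t; rewrite !indicE in_setC.
    by case: (_ \in A) => /=; ring.
  - move=> F SF; rewrite /S /=.
    apply: (multiplier_cvg CA (M := 1)
      (F := fun n t => \1_(\big[setU/set0]_(i < n) F i) (X t))).
    + elim=> [|n ih].
        have := multiplier_cst CA 0; congr multiplier.
        by apply/funext => t; rewrite big_ord0 indic0.
      have := SU _ _ ih (SF n); rewrite /S /=; congr multiplier.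
      by apply/funext => t; rewrite big_ord_recr.
    + by move=> n t; rewrite indicE; case: (_ \in _); rewrite ?normr1 ?normr0.
    + move=> t; apply: cvg_near_cst.
      have [[k _ Fk]|nF] := pselect ((\bigcup_k F k) (X t)).
        exists k.+1 => // n /= kn; rewrite !indicE !mem_set//; first by exists k.
        by rewrite -bigcup_mkord; exists k.
      apply: nearW => n; rewrite !indicE !memNset//.
      by rewrite -bigcup_mkord => -[k _ Fk]; apply: nF; exists k.
have mid : measurable_fun setT (id : g_sigma_algebraType S -> 'rV[R]_N).
  apply: measurable_fun_rV => i.
  apply: (measurability _ (RGenOInfty.measurableE R)).
  move=> _ [_ [a ->] <-]; rewrite setTI; apply: sub_sigma_algebra.
  have := multiplier_coord_gt i a; rewrite /S /=; congr multiplier.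
  apply/funext => t; rewrite !indicE; congr (_ _)%:R.
  by apply/idP/idP; rewrite !inE /= in_itv /= andbT.
move=> mB; have := mid measurableT B mB; rewrite setTI preimage_id.
by rewrite /measurable/= sigma_algebra_id.
Qed.

(** A nonnegative g is the increasing limit of simple functions, which g itself
    dominates; in general g is split into its positive and negative parts. *)
Lemma l2_closure_borel (g : 'rV[R]_N -> R) : measurable_fun setT g ->
  L2 P (fun t => g (X t)) -> l2_closure P C (fun t => g (X t)).
Proof.
have pos (h : 'rV[R]_N -> R) : measurable_fun setT h -> (forall x, 0 <= h x) ->
    L2 P (fun t => h (X t)) -> l2_closure P C (fun t => h (X t)).
  move=> mh h0 h2; have mhE : measurable_fun setT (EFin \o h) by exact/measurable_EFinP.
  pose F := nnsfun_approx measurableT mhE.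
  have cF x : F n x @[n --> \oo] --> h x.
    have hE (y : 'rV[R]_N) : setT y -> (0 <= (EFin \o h) y)%E.
      by rewrite /= lee_fin.
    by have /fine_cvg := @cvg_nnsfun_approx _ _ _ _ measurableT _ mhE hE x I.
  have Fh n x : F n x <= h x.
    rewrite -(cvg_lim _ (cF x))//; apply: nondecreasing_cvgn_le.
      by move=> a b ab; exact/lefP/nd_nnsfun_approx.
    by apply/cvg_ex; exists (h x).
  apply: (l2_closure_dominated CA (F := fun n t => F n (X t)) _ h2).
  - move=> n; apply: (multiplier_l2_closure CA).
    have := fimfunEord (F n); set s := fset_set _ => FE.
    rewrite (_ : (fun t => F n (X t)) = fun t => \sum_(i < #|`s|)
      s`_i * \1_(F n @^-1` [set s`_i]) (X t)); last by apply/funext => t; exact: FE.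
    elim: #|`s| => [|m ih].
      have := multiplier_cst CA 0; congr multiplier.
      by apply/funext => t; rewrite big_ord0.
    have := multiplierD CA ih (multiplierM (multiplier_cst CA s`_m)
      (multiplier_borel (measurable_sfunP (F n) (measurable_set1 s`_m)))).
    by congr multiplier; apply/funext => t; rewrite big_ord_recr.
  - by move=> n t; rewrite ger0_norm// ger0_norm.
  - by move=> t; exact: cF.
move=> mg g2.
have mgX : measurable_fun setT (g \o X) := L2_measurable g2.
have p2 : L2 P (fun t => g^\+ (X t)).
  apply: (L2_dominated _ g2); first exact: measurable_funrpos mgX.
  move=> t; rewrite ger0_norm ?funrpos_ge0//.
  by rewrite -[leRHS]/((Num.norm \o g) (X t)) -funrposDneg lerDl funrneg_ge0.
have n2 : L2 P (fun t => g^\- (X t)).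
  apply: (L2_dominated _ g2); first exact: measurable_funrneg mgX.
  move=> t; rewrite ger0_norm ?funrneg_ge0//.
  by rewrite -[leRHS]/((Num.norm \o g) (X t)) -funrposDneg lerDr funrpos_ge0.
have cp := pos _ (measurable_funrpos mg) (funrpos_ge0 g) p2.
have cn := pos _ (measurable_funrneg mg) (funrneg_ge0 g) n2.
have [_ _ /(_ _ cn) cN] := multiplier_cst CA (-1).
have := l2_closureD CA cp cN; congr l2_closure; apply/funext => t.
by rewrite mulN1r -[in RHS](funrposBneg g).
Qed.

End borel_density.

(** * Integration against a measure given by a density *)

Section measure_with_density.
Context d (T : measurableType d) (R : realType).
Variables (mu nu : {measure set T -> \bar R}) (D : set T) (f : T -> R).
Hypotheses (mD : measurable D) (mf : measurable_fun D f) (f0 : forall x, 0 <= f x).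
Hypothesis nuE : forall B, measurable B ->
  nu B = (\int[mu]_(x in D `&` B) (f x)%:E)%E.
Import HBNNSimple.
Local Open Scope ereal_scope.

Let mfE (g : T -> R) : measurable_fun setT g ->
  measurable_fun D (fun x => (g x * f x)%:E).
Proof.
move=> mg; apply/measurable_EFinP; apply: measurable_funM => //.
exact: measurable_funTS.
Qed.

(** Both sides are limits along an increasing sequence of simple functions, on
    which the identity is the hypothesis on [nu]. *)
Lemma ge0_integral_density (g : T -> R) : measurable_fun setT g ->
  (forall x, 0 <= g x)%R ->
  \int[nu]_x (g x)%:E = \int[mu]_(x in D) (g x * f x)%:E.
Proof.
move=> mg g0; have mgE : measurable_fun setT (EFin \o g) by exact/measurable_EFinP.
have gE0 (x : T) : setT x -> 0 <= (EFin \o g) x by rewrite /= lee_fin.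
pose h := nnsfun_approx measurableT mgE.
have hg x : (h n x)%:E @[n --> \oo] --> (g x)%:E.
  exact: (@cvg_nnsfun_approx _ _ _ _ measurableT _ mgE gE0 x I).
have hnd x : {homo (fun n => h n x) : m n / (m <= n)%N >-> (m <= n)%R}.
  by move=> m n mn; exact/lefP/nd_nnsfun_approx.
have mh n : measurable_fun setT (h n) by exact: measurable_funP.
have -> : \int[nu]_x (g x)%:E = limn (fun n => \int[nu]_x (h n x)%:E).
  rewrite -monotone_convergence//.
  - by apply: eq_integral => x _; exact/esym/cvg_lim.
  - by move=> n; exact/measurable_EFinP.
  - by move=> n x _; rewrite lee_fin.
  - by move=> x _ m n mn; rewrite lee_fin; exact: hnd.
have -> : \int[mu]_(x in D) (g x * f x)%:E =
    limn (fun n => \int[mu]_(x in D) (h n x * f x)%:E).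
  rewrite -monotone_convergence//.
  - apply: eq_integral => x _; apply/esym/cvg_lim => //.
    under eq_fun do rewrite EFinM.
    by rewrite EFinM; apply: cvgeZr.
  - by move=> n; exact: mfE.
  - by move=> n x _; rewrite lee_fin mulr_ge0.
  - by move=> x _ m n mn; rewrite lee_fin ler_wpM2r//; exact: hnd.
congr (limn _); apply/funext => n.
transitivity (\int[nu]_x
    (\sum_(y \in range (h n)) (y * \1_(h n @^-1` [set y]) x)%:E)).
  by apply: eq_integral => x _; rewrite /= fimfunE -fsumEFin.
have mind r : measurable_fun setT (fun x => (r * \1_(h n @^-1` [set r]) x)%R).
  exact: measurable_funM.
rewrite ge0_integral_fsum//; first last.
- by move=> r x _; rewrite nnfun_muleindic_ge0.
- by move=> r; exact/measurable_EFinP.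
transitivity (\int[mu]_(x in D)
    (\sum_(y \in range (h n)) (y * \1_(h n @^-1` [set y]) x * f x)%:E)); last first.
  apply: eq_integral => x _; rewrite fsumEFin// -mulr_fsuml.
  by rewrite -fimfunE.
rewrite ge0_integral_fsum//; first last.
- move=> r x _; rewrite EFinM mule_ge0 ?lee_fin//.
  by have := nnfun_muleindic_ge0 (h n) r x; rewrite lee_fin.
- by move=> r; exact: mfE.
apply: eq_fsbigr => r; rewrite inE => -[x0 _ rE].
have r0 : (0 <= r)%R by rewrite -rE.
have mr : measurable (h n @^-1` [set r]) by exact: measurable_sfunP.
under eq_integral do rewrite EFinM.
rewrite ge0_integralZl_EFin//; last by apply/measurable_EFinP; exact: measurable_indic.
rewrite integral_indic// setIT nuE//.
under [RHS]eq_integral do rewrite -mulrA EFinM.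
rewrite ge0_integralZl_EFin//; first last.
  - by apply: mfE; exact: measurable_indic.
  - by move=> x _; rewrite lee_fin mulr_ge0.
congr (_ * _); rewrite integral_mkcondr; apply: eq_integral => x _.
by rewrite patchE indicE; case: (x \in _); rewrite ?mul1r ?mul0r.
Qed.

Lemma integrable_density (g : T -> R) : measurable_fun setT g ->
  nu.-integrable setT (EFin \o g) ->
  mu.-integrable D (fun x => (g x * f x)%:E).
Proof.
move=> mg /integrableP[_ ig]; apply/integrableP; split; first exact: mfE.
apply: le_lt_trans ig; rewrite (eq_integral (fun x => (`|g x| * f x)%:E)).
  by rewrite -ge0_integral_density//; exact: measurableT_comp.
by move=> x _; rewrite /= normrM (ger0_norm (f0 x)).
Qed.

Lemma Rintegral_density (g : T -> R) : measurable_fun setT g ->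
  nu.-integrable setT (EFin \o g) ->
  (\int[nu]_x g x = \int[mu]_(x in D) (g x * f x))%R.
Proof.
move=> mg ig.
have mp := measurable_funrpos mg; have mn := measurable_funrneg mg.
have ip : nu.-integrable setT (EFin \o g^\+%R).
  by rewrite -funerpos; exact: integrable_funepos.
have in_ : nu.-integrable setT (EFin \o g^\-%R).
  by rewrite -funerneg; exact: integrable_funeneg.
transitivity (\int[nu]_x (g^\+ x - g^\- x))%R.
  by apply: eq_Rintegral => x _; rewrite -[in LHS](funrposBneg g).
rewrite RintegralB//.
transitivity (\int[mu]_(x in D) (g^\+ x * f x - g^\- x * f x))%R; last first.
  apply: eq_Rintegral => x _; rewrite -mulrBl; congr (_ * _)%R.
  by rewrite -[in RHS](funrposBneg g).
rewrite RintegralB//; [|exact: integrable_density..].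
by congr (_ - _)%R; congr fine; exact: ge0_integral_density.
Qed.

End measure_with_density.

(** * Spans, polynomials and norms *)

Section linear_spans.
Context {R : realType} (T : Type).
Implicit Types (S C : set (T -> R)) (u v : T -> R).

Lemma lin_span_ind S C : C (fun=> 0) ->
  (forall u v, C u -> C v -> C (fun t => u t + v t)) ->
  (forall c u, S u -> C (fun t => c * u t)) -> lin_span S `<=` C.
Proof.
move=> C0 CD CZ g [n [c [s [Ss gE]]]].
rewrite (_ : g = fun t => \sum_(i < n) c i * s i t); last exact/funext.
elim: n c s Ss {gE} => [|n ih] c s Ss.
  rewrite (_ : (fun t => _) = fun=> 0)//.
  by apply/funext => t; rewrite big_ord0.
under eq_fun do rewrite big_ord_recr /=.
by apply: CD; [exact: ih|exact: CZ].
Qed.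

Lemma lin_span0 S : lin_span S (fun=> 0).
Proof.
exists 0%N, (fun=> 0), (fun=> fun=> 0); split; first by case.
by move=> t; rewrite big_ord0.
Qed.

Lemma lin_spanD S u v : lin_span S u -> lin_span S v ->
  lin_span S (fun t => u t + v t).
Proof.
move=> [n [c [s [Ss uE]]]] [m [c' [s' [Ss' vE]]]].
exists (n + m)%N,
  (fun i => match fintype.split i with inl j => c j | inr j => c' j end),
  (fun i => match fintype.split i with inl j => s j | inr j => s' j end).
split; first by move=> i; case: (fintype.split i).
move=> t; rewrite uE vE big_split_ord /=; congr (_ + _).
  by apply: eq_bigr => i _; rewrite (unsplitK (inl i)).
by apply: eq_bigr => i _; rewrite (unsplitK (inr i)).
Qed.

Lemma lin_spanZ S a u : lin_span S u -> lin_span S (fun t => a * u t).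
Proof.
move=> [n [c [s [Ss uE]]]]; exists n, (fun i => a * c i), s; split => // t.
by rewrite uE mulr_sumr; apply: eq_bigr => i _; rewrite mulrA.
Qed.

Lemma sub_lin_span S : S `<=` lin_span S.
Proof.
move=> u Su; exists 1%N, (fun=> 1), (fun=> u); split => // t.
by rewrite big_ord1 mul1r.
Qed.

Lemma lin_span_sum S n (F : 'I_n -> T -> R) :
  (forall i, lin_span S (F i)) -> lin_span S (fun t => \sum_(i < n) F i t).
Proof.
elim: n F => [|n ih] F SF.
  rewrite (_ : (fun t => _) = fun=> 0); first exact: lin_span0.
  by apply/funext => t; rewrite big_ord0.
under eq_fun do rewrite big_ord_recr /=.
by apply: lin_spanD => //; exact: ih.
Qed.

Lemma lin_span_subset S S' : S `<=` lin_span S' -> lin_span S `<=` lin_span S'.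
Proof.
move=> SS'; apply: lin_span_ind; first exact: lin_span0.
  by move=> u v; exact: lin_spanD.
by move=> c u /SS'; exact: lin_spanZ.
Qed.

End linear_spans.

Section polynomials.
Context {R : realType} (N : nat).
Implicit Types (p q : 'rV[R]_N -> R) (j k : multiindex N) (x : 'rV[R]_N).

Lemma monomialM j k x : monomial j x * monomial k x = monomial (j + k) x.
Proof.
by rewrite /monomial -big_split; apply: eq_bigr => i _; rewrite ffunE exprD.
Qed.

Lemma mdegreeD j k : mdegree (j + k) = (mdegree j + mdegree k)%N.
Proof. by rewrite /mdegree -big_split; apply: eq_bigr => i _; rewrite ffunE. Qed.

Lemma monomial0 x : monomial 0 x = 1.
Proof. by rewrite /monomial big1// => i _; rewrite ffunE. Qed.

Lemma mdegree0 : mdegree (0 : multiindex N) = 0%N.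
Proof. by rewrite /mdegree big1// => i _; rewrite ffunE. Qed.

Definition delta_index (i : 'I_N) : multiindex N := [ffun k => (k == i) : nat].

Lemma monomial_delta i x : monomial (delta_index i) x = x ord0 i.
Proof.
rewrite /monomial (bigD1 i)//= ffunE eqxx expr1 big1 ?mulr1// => k ki.
by rewrite ffunE (negbTE ki) expr0.
Qed.

Lemma poly_space_monomial j m : (mdegree j <= m)%N -> poly_space m (@monomial R N j).
Proof. by move=> jm; apply: sub_lin_span; exists j. Qed.

Lemma poly_space_le m n p : (m <= n)%N -> poly_space m p -> poly_space n p.
Proof.
move=> mn; apply: lin_span_subset => _ [j /= jm <-].
by apply: poly_space_monomial; exact: leq_trans mn.
Qed.

(** Two inductions over spans reduce the product to a product of monomials. *)
Lemma poly_spaceM m n p q : poly_space m p -> poly_space n q ->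
  poly_space (m + n) (fun x => p x * q x).
Proof.
move=> pm qn; move: p pm.
pose C : set ('rV[R]_N -> R) := [set p | poly_space (m + n) (fun x => p x * q x)].
apply: (@lin_span_ind _ _ _ C); rewrite /C /=.
- under eq_fun do rewrite mul0r.
  exact: lin_span0.
- by move=> u v Cu Cv; under eq_fun do rewrite mulrDl; exact: lin_spanD.
move=> c _ [j /= jm <-]; under eq_fun do rewrite -mulrA; apply: lin_spanZ.
move: q qn {C}.
pose C : set ('rV[R]_N -> R) :=
  [set q | poly_space (m + n) (fun x => monomial j x * q x)].
apply: (@lin_span_ind _ _ _ C); rewrite /C /=.
- under eq_fun do rewrite mulr0.
  exact: lin_span0.
- by move=> u v Cu Cv; under eq_fun do rewrite mulrDr; exact: lin_spanD.
move=> {}c _ [k /= km <-].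
have -> : (fun x : 'rV[R]_N => monomial j x * (c * monomial k x)) =
    fun x => c * monomial (j + k) x.
  by apply/funext => x; rewrite -monomialM mulrCA.
by apply: lin_spanZ; apply: poly_space_monomial; rewrite mdegreeD leq_add.
Qed.

Lemma poly_space_cst c m : poly_space m (fun _ : 'rV[R]_N => c).
Proof.
rewrite (_ : (fun _ => c) = fun x => c * monomial 0 x); last first.
  by apply/funext => x; rewrite monomial0 mulr1.
by apply: lin_spanZ; apply: poly_space_monomial; rewrite mdegree0.
Qed.

Lemma measurable_monomial j : measurable_fun setT (@monomial R N j).
Proof.
rewrite /monomial; elim: (index_enum _) => [|i s ih].
  by under eq_fun do rewrite big_nil; exact: measurable_cst.
under eq_fun do rewrite big_cons; apply: measurable_funM => //.
by apply: measurable_funX; exact: measurable_rV_coord.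
Qed.

Lemma measurable_poly_space m p : poly_space m p -> measurable_fun setT p.
Proof.
move: p; apply: lin_span_ind; first exact: measurable_cst.
  by move=> u v mu mv; exact: measurable_funD.
move=> c _ [j _ <-]; apply: measurable_funM; first exact: measurable_cst.
exact: measurable_monomial.
Qed.

End polynomials.

Section norms.
Context {R : realType} (N : nat) (nrm : 'rV[R]_N -> R).
Hypothesis nrm_norm : is_norm nrm.

Lemma coord_le_norm (x : 'rV[R]_N) i : `|x ord0 i| <= `|x|.
Proof.
rewrite /Num.norm/= mx_normrE.
exact: (@le_bigmax _ _ _ 0 (fun k : 'I_1 * 'I_N => `|x k.1 k.2|) (ord0, i)).
Qed.

Lemma is_norm0 : nrm 0 = 0.
Proof.
by have [_ _ nZ _] := nrm_norm; rewrite -(scale0r 0) nZ normr0 mul0r.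
Qed.

Lemma is_norm_le_mx_norm : exists2 M : R, 0 <= M & forall x, nrm x <= M * `|x|.
Proof.
have [n0 _ nZ nD] := nrm_norm.
exists (\sum_(i < N) nrm (delta_mx 0 i)).
  by apply: sumr_ge0 => i _; exact: n0.
move=> x; rewrite [in leLHS](row_sum_delta x).
apply: (@le_trans _ _ (\sum_(i < N) nrm (x 0 i *: delta_mx 0 i))).
  elim/big_rec2: _ => [|i u v _ uv]; first by rewrite is_norm0.
  by rewrite (le_trans (nD _ _))// lerD2l.
rewrite mulr_suml ler_sum// => i _; rewrite nZ mulrC ler_wpM2l ?n0//.
exact: coord_le_norm.
Qed.

Lemma is_norm_continuous : continuous nrm.
Proof.
have [n0 _ nZ nD] := nrm_norm; have [M M0 nM] := is_norm_le_mx_norm.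
move=> x; have FF := nbhs_filter (x : 'rV[R]_N).
apply/(@cvgrPdist_le _ _ _ _ FF) => e e0.
have M1 : 0 < M + 1 by rewrite ltr_wpDl.
have nB u v : nrm u - nrm v <= M * `|u - v|.
  by rewrite lerBlDr (le_trans _ (lerD (nM (u - v)) (lexx _)))// -{1}(subrK v u).
have /cvgrPdist_le/(_ _ (divr_gt0 e0 M1)) : y @[y --> x] --> x by exact: cvg_id.
apply: filterS => y xy1; have xy : M * `|x - y| <= e.
  apply: (@le_trans _ _ ((M + 1) * `|x - y|)); first by rewrite ler_wpM2r// lerDl.
  by rewrite mulrC -ler_pdivlMr.
rewrite ler_norml; apply/andP; split; last exact: le_trans (nB _ _) xy.
by rewrite lerNl opprB (le_trans (nB _ _))// distrC.
Qed.

(** Half of the equivalence of norms in finite dimension: the constant is the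
    minimum of the norm on the unit sphere of the supremum norm, which is
    compact. *)
Lemma coord_le_is_norm : exists2 c : R, 0 < c &
  forall (x : 'rV[R]_N) i, c * `|x ord0 i| <= nrm x.
Proof.
have [n0 nI nZ nD] := nrm_norm.
suff [c c0 cn] : exists2 c : R, 0 < c & forall x, c * `|x| <= nrm x.
  exists c => // x i; apply: le_trans (cn x).
  by rewrite ler_pM2l//; exact: coord_le_norm.
pose S : set 'rV[R]_N := [set x | `|x| = 1].
have normS x : x != 0 -> S (`|x|^-1 *: x).
  move=> x0; rewrite /S /= normrZ normfV normr_id mulVf// normr_eq0//.
have [S0|/set0P S0] := eqVneq S set0.
  exists 1 => // x; have [->|x0] := eqVneq x 0; first by rewrite normr0 mulr0 n0.
  by have := normS _ x0; rewrite S0.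
have cS : compact S.
  apply: bounded_closed_compact.
    exists 1; split; first exact: num_real.
    by move=> M M1 x /= ->; exact: ltW.
  apply: (@closed_comp _ _ (fun x : 'rV[R]_N => `|x|) [set 1]) => //.
    by move=> x _; exact: norm_continuous.
have [a aS amin] := EVT_min_rV S0 cS (continuous_subspaceT is_norm_continuous).
have a0 : nrm a != 0.
  apply/eqP => /nI aE; move: aS; rewrite inE /S /= aE normr0 => /eqP.
  by rewrite eq_sym oner_eq0.
exists (nrm a); first by rewrite lt0r a0 n0.
move=> x; have [->|x0] := eqVneq x 0; first by rewrite normr0 mulr0 n0.
have := amin (`|x|^-1 *: x); rewrite inE => /(_ (normS _ x0)).
by rewrite nZ normfV normr_id mulrC ler_pdivlMr ?normr_gt0.
Qed.

End norms.

(** * Polynomials in the input vector *)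

Lemma within_continuous_measurable (R : realType) N (A : set 'rV[R]_N)
  (f : 'rV[R]_N -> R) : measurable A -> {within A, continuous f} ->
  measurable_fun A f.
Proof.
move=> mA cf; apply: (measurability _ (RGenOpens.measurableE R)).
move=> _ [_ [a [b ->]] <-].
have /open_subspaceP[V oV VA] : open (f @^-1` `]a, b[ : set (subspace A)).
  by move/continuousP: cf; apply.
rewrite setIC -VA; apply: measurableI => //; exact: sub_sigma_algebra.
Qed.

Section input.
Context (R : realType) (d : measure_display) (Omega : measurableType d).
Context (P : probability Omega R) (N : nat) (A : set 'rV[R]_N).
Context (X : {RV P >-> 'rV[R]_N}) (f nrm : 'rV[R]_N -> R).
Hypothesis nrm_norm : is_norm nrm.
Hypothesis X_input : input_assumption A X f nrm.

Let mA := input_domain X_input.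
Let f0 := density_ge0 X_input.

Let mf : measurable_fun A f.
Proof. exact: within_continuous_measurable mA (density_continuous X_input). Qed.

Let mX : measurable_fun setT X. Proof. exact: measurable_funPT. Qed.

Lemma ge0_expectation_density (g : 'rV[R]_N -> R) : measurable_fun setT g ->
  (forall x, 0 <= g x) ->
  (\int[P]_w (g (X w))%:E = \int[lebesgue_rV N]_(x in A) (g x * f x)%:E)%E.
Proof.
move=> mg g0; rewrite -(ge0_integral_density mA mf f0
  (density_distribution X_input) mg g0).
rewrite ge0_integral_distribution//; first exact/measurable_EFinP.
Qed.

Lemma Rexpectation_density (g : 'rV[R]_N -> R) : measurable_fun setT g ->
  P.-integrable setT (EFin \o (fun w => g (X w))) ->
  \int[P]_w g (X w) = \int[lebesgue_rV N]_(x in A) (g x * f x).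
Proof.
move=> mg ig; have mgE : measurable_fun setT (EFin \o g) by exact/measurable_EFinP.
rewrite -(Rintegral_density mA mf f0 (density_distribution X_input) mg).
  by congr fine; rewrite (integral_distribution mgE).
exact: (integrable_pushforward mX mgE).
Qed.

Lemma integrable_monomial (j : multiindex N) :
  P.-integrable setT (EFin \o (fun w => monomial j (X w))).
Proof.
have mm := @measurable_monomial R N j.
apply/integrableP; split.
  by apply/measurable_EFinP; exact: measurableT_comp.
have := @ge0_expectation_density (fun x => `|monomial j x|) _ (fun x => normr_ge0 _).
by rewrite /= => ->; [exact: input_moments X_input j|exact: measurableT_comp].
Qed.

Definition polyX : set (Omega -> R) :=
  [set U | exists m p, poly_space m p /\ U = p \o X].

Lemma integrable_poly m p : poly_space m p ->
  P.-integrable setT (EFin \o (fun w => p (X w))).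
Proof.
move: p.
pose C : set ('rV[R]_N -> R) :=
  [set p | P.-integrable setT (EFin \o (fun w => p (X w)))].
apply: (@lin_span_ind _ _ _ C); rewrite /C /=.
- exact: integrable0.
- by move=> u v iu iv; exact: (integrableD measurableT iu iv).
- move=> c _ [j _ <-].
  exact: (integrableZl measurableT c (integrable_monomial j)).
Qed.

Lemma L2_poly m p : poly_space m p -> L2 P (fun w => p (X w)).
Proof.
move=> pm; apply/L2P; split.
  by apply: measurableT_comp => //; exact: measurable_poly_space pm.
under eq_fun do rewrite expr2.
exact: (integrable_poly (poly_spaceM pm pm)).
Qed.

Lemma polyX_algebra : L2_algebra P polyX.
Proof.
split.
- by move=> _ [m [p [pm ->]]]; exact: L2_poly pm.
- move=> c; exists 0%N, (fun=> c); split => //; exact: poly_space_cst.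
- move=> _ _ [m [p [pm ->]]] [n [q [qn ->]]].
  exists (maxn m n), (fun x => p x + q x); split => //; apply: lin_spanD.
    by apply: poly_space_le pm; exact: leq_maxl.
  by apply: poly_space_le qn; exact: leq_maxr.
- move=> _ _ [m [p [pm ->]]] [n [q [qn ->]]].
  by exists (m + n)%N, (fun x => p x * q x); split => //; exact: poly_spaceM.
Qed.

Lemma polyX_coord i : polyX (fun w => X w ord0 i).
Proof.
exists 1%N, (monomial (delta_index i)); split; last first.
  by apply/funext => w /=; rewrite monomial_delta.
apply: poly_space_monomial; rewrite /mdegree (bigD1 i)//= ffunE eqxx big1//.
by move=> k ki; rewrite ffunE (negbTE ki).
Qed.

(** Both forms of the tail condition give the same consequence: on a compact
    set the coordinates are bounded, and otherwise the arbitrary norm dominates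
    a multiple of every coordinate. *)
Lemma exponential_moment : exists2 alpha : R, 0 < alpha & forall i,
  P.-integrable setT (EFin \o (fun w => expR (alpha * `|X w ord0 i|))).
Proof.
have mexp a i : measurable_fun setT (fun x : 'rV[R]_N => expR (a * `|x ord0 i|)).
  apply: measurableT_comp => //; apply: measurable_funM => //.
  by apply: measurableT_comp => //; exact: measurable_rV_coord.
have mexpX a i : measurable_fun setT (fun w => expR (a * `|X w ord0 i|)).
  exact: (measurableT_comp (mexp a i)).
have [[C cC PC]|[a a0 aint]] := input_tail X_input.
- exists 1 => // i; apply/integrableP; split; first exact/measurable_EFinP.
  have mC : measurable C.
    rewrite -[C]setCK; apply: measurableC; apply: sub_sigma_algebra.
    by apply: closed_openC; apply: compact_closed => //; exact: norm_hausdorff.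
  have mXC : measurable (X @^-1` C).
    by rewrite -[X in measurable X]setTI; exact: mX.
  have PXC0 : P (~` (X @^-1` C)) = 0%E.
    by rewrite probability_setC// PC subee.
  have [M [_ CM]] := compact_bounded cC.
  have {}CM x : C x -> `|x| <= M + 1 by apply: CM; rewrite ltrDl.
  rewrite (ge0_negligible_integral _ _ _ _ PXC0)//=; last 2 first.
  + exact: measurableC.
  + by apply/measurable_EFinP; exact: measurableT_comp.
  rewrite setTD setCK.
  apply: (@le_lt_trans _ _ (\int[P]_(w in X @^-1` C) (expR (M + 1))%:E)%E).
    apply: ge0_le_integral => //.
    + by apply: measurable_funTS; apply/measurable_EFinP; exact: measurableT_comp.
    + move=> w /CM wM; rewrite lee_fin ger0_norm ?expR_ge0// ler_expR mul1r.
      exact: le_trans (coord_le_norm _ _) wM.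
  by rewrite integral_cst// [Y in (_ * Y)%E]PC mule1 ltry.
- have [c c0 cn] := coord_le_is_norm nrm_norm.
  exists (a * c); first exact: mulr_gt0.
  move=> i; apply/integrableP; split; first exact/measurable_EFinP.
  apply: le_lt_trans aint.
  have -> : (\int[P]_w `|(EFin \o (fun w0 => expR (a * c * `|X w0 ord0 i|))) w| =
      \int[P]_w (expR (a * c * `|X w ord0 i|))%:E)%E.
    by apply: eq_integral => w _; rewrite /= ger0_norm ?expR_ge0.
  rewrite (@ge0_expectation_density (fun x => expR (a * c * `|x ord0 i|)))//.
  apply: ge0_le_integral => //.
  + by move=> x _; rewrite lee_fin mulr_ge0 ?expR_ge0.
  + apply/measurable_EFinP; apply: measurable_funM => //.
    by apply: measurable_funTS.
  + apply/measurable_EFinP; apply: measurable_funM => //.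
    apply: measurable_funTS; apply: measurableT_comp => //.
    apply: measurable_funM => //.
    apply: within_continuous_measurable => //.
    by apply: continuous_subspaceT; exact: is_norm_continuous.
  + move=> x _; rewrite lee_fin ler_wpM2r// ler_expR -mulrA ler_pM2l//.
Qed.

(** Only the values of y on A matter, so y is extended by 0 to a function that
    is measurable on the whole space. *)
Lemma polynomials_dense (y : 'rV[R]_N -> R) : measurable_fun A y ->
  L2 P (fun w => y (X w)) -> l2_closure P polyX (fun w => y (X w)).
Proof.
move=> my y2; pose y' := y \_ A.
have yE : (fun w => y (X w)) = (fun w => y' (X w)).
  by apply/funext => w; rewrite /y' patchE mem_set//; exact: input_range X_input w.
rewrite yE in y2 *; apply: (l2_closure_borel polyX_algebra) => //.
  move=> i a; have [alpha a0 ai] := exponential_moment.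
  exact: (multiplier_gt polyX_algebra (polyX_coord i) a0 (ai i)).
by apply/(measurable_restrictT _ _).1.
Qed.

End input.

(** * Orthonormality, spanning and best approximation *)

Section orthogonal_complement.
Context d (T : measurableType d) (R : realType) (P : probability T R).
Implicit Types E U : T -> R.

Definition perp E : set (T -> R) := [set U | L2 P U /\ ip P E U = 0].

Lemma perp0 E : L2 P E -> perp E (fun=> 0).
Proof.
move=> E2; split; first exact: L2_cst.
rewrite ipC -[RHS](mul0r (ip P E E)) -ipZl//.
by congr (ip P _ E); apply/funext => t; rewrite mul0r.
Qed.

Lemma perpD E U V : L2 P E -> perp E U -> perp E V ->
  perp E (fun t => U t + V t).
Proof.
move=> E2 [U2 EU] [V2 EV]; split; first exact: L2D.
by rewrite ipC ipDl// ipC EU ipC EV addr0.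
Qed.

Lemma lin_span_perp E (S : set (T -> R)) : L2 P E -> S `<=` perp E ->
  lin_span S `<=` perp E.
Proof.
move=> E2 SE; apply: lin_span_ind; first exact: perp0.
  by move=> u v; exact: perpD.
move=> c u /SE[u2 Eu]; split; first exact: L2Z.
by rewrite ipC ipZl// ipC Eu mulr0.
Qed.

(** Pythagoras: the best approximation of Y is its orthogonal projection E. *)
Lemma perp_sqdist_le Y E p : L2 P Y -> L2 P E ->
  perp (fun t => Y t - E t) (fun t => E t - p t) -> sqdist P Y E <= sqdist P Y p.
Proof.
move=> Y2 E2 [V2 EV]; set U := fun t => Y t - E t in EV.
set V := fun t => E t - p t in V2 EV.
have U2 : L2 P U by exact: L2B.
have -> : sqdist P Y p = ip P U U + ip P V V.
  rewrite sqdistE (_ : (fun t => Y t - p t) = fun t => U t + V t); last first.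
    by apply/funext => t; rewrite subrKA.
  have UV2 := L2D U2 V2.
  have VU : ip P V U = 0 by rewrite ipC.
  by rewrite ipDl// ipC ipDl// VU addr0 [in X in _ + X]ipC ipDl// EV add0r.
rewrite sqdistE lerDl; apply: Rintegral_ge0 => t _; rewrite -expr2; exact: sqr_ge0.
Qed.

End orthogonal_complement.

Lemma lin_span_comp (R : realType) (T T' : Type) (h : T' -> T)
    (S : set (T -> R)) p :
  lin_span S p -> lin_span [set u \o h | u in S] (p \o h).
Proof.
move=> [n [c [s [Ss pE]]]]; exists n, c, (fun i => s i \o h); split.
  by move=> i; exists (s i).
by move=> t; rewrite /= pE.
Qed.

Definition poly_lower {R : realType} N l : set ('rV[R]_N -> R) :=
  lin_span [set @monomial R N j | j in [set j | (mdegree j < l)%N]].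

Lemma poly_space_lower {R : realType} N l m (p : 'rV[R]_N -> R) :
  (m < l)%N -> poly_space m p -> poly_lower l p.
Proof.
move=> ml; apply: lin_span_subset => _ [j /= jm <-]; apply: sub_lin_span.
by exists j => //=; exact: leq_ltn_trans ml.
Qed.

Lemma poly_lowerW {R : realType} N l (p : 'rV[R]_N -> R) :
  poly_lower l p -> poly_space l p.
Proof.
apply: lin_span_subset => _ [j /= jl <-]; apply: poly_space_monomial.
exact: ltnW.
Qed.

Section projection.
Context (R : realType) (d : measure_display) (Omega : measurableType d).
Context (P : probability Omega R) (N : nat) (A : set 'rV[R]_N).
Context (X : {RV P >-> 'rV[R]_N}) (f nrm : 'rV[R]_N -> R).
Hypothesis X_input : input_assumption A X f nrm.
Context (le : rel (multiindex N)) (jj : forall l, 'I_(K N l) -> multiindex N).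
Arguments jj : clear implicits.
Hypothesis jj_listing : monomial_listing le jj.
Context (Q : multiindex N -> 'rV[R]_N -> R).
Hypothesis Q_orthogonal : orthogonal_polynomials jj A f Q.
Context (W : forall l, 'M[R]_(K N l)).
Hypothesis W_whitening : whitening jj X Q W.

Let psi l i x : R := Psi jj Q W l x i ord0.
Arguments psi : clear implicits.

Let Q_poly l k : poly_space l (Q (jj l k)).
Proof.
have := op_degree Q_orthogonal (jj l k).
by rewrite (listing_degree jj_listing).
Qed.

Let Q_L2 l k : L2 P (fun w => Q (jj l k) (X w)).
Proof. exact: (L2_poly X_input (Q_poly k)). Qed.

Lemma psiE l i x : psi l i x = \sum_k W l i k * Q (jj l k) x.
Proof. by rewrite /psi /Psi mxE; apply: eq_bigr => k _; rewrite mxE. Qed.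

Lemma psi_poly l i : poly_space l (psi l i).
Proof.
rewrite (_ : psi l i = fun x => \sum_k W l i k * Q (jj l k) x); last first.
  by apply/funext => x; exact: psiE.
by apply: lin_span_sum => k; apply: lin_spanZ; exact: Q_poly.
Qed.

Lemma psi_L2 l i : L2 P (fun w => psi l i (X w)).
Proof. exact: (L2_poly X_input (psi_poly i)). Qed.

(** The defining orthogonality relation concerns integrals against the density,
    monomial by monomial; it is transported to expectations and extended by
    linearity. *)
Lemma Q_perp_lower l k p : poly_lower l p ->
  perp P (fun w => Q (jj l k) (X w)) (fun w => p (X w)).
Proof.
move=> /(lin_span_comp X) pm; apply: (lin_span_perp _ _ pm) => //.
move=> _ [_ [j /= jl <-] <-].
have j2 : L2 P (fun w => monomial j (X w)).
  exact: (L2_poly X_input (poly_space_monomial (leqnn _))).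
split => //.
have [i jE] := listing_surj jj_listing (erefl (mdegree j)).
have /matrixP/(_ i k) := op_orthogonal Q_orthogonal jl.
rewrite !mxE => <-; rewrite ipC /ip /=.
rewrite (Rexpectation_density X_input
  (g := fun x => monomial j x * Q (jj l k) x)).
- apply: eq_Rintegral => x _; rewrite !mxE big_ord1 !mxE jE.
  by rewrite mulrC.
- apply: measurable_funM; first exact: measurable_monomial.
  exact: (measurable_poly_space (Q_poly k)).
- exact: (L2_integrableM j2 (Q_L2 k)).
Qed.

Lemma psi_perp_poly l m i p : (m < l)%N -> poly_space m p ->
  perp P (fun w => p (X w)) (fun w => psi l i (X w)).
Proof.
move=> ml pm; have p2 := L2_poly X_input pm.
split; first exact: psi_L2.
have -> : (fun w => psi l i (X w)) =
    fun w => \sum_k W l i k * Q (jj l k) (X w).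
  by apply/funext => w; rewrite psiE.
rewrite ipC ip_suml// => [|k]; last exact: (L2Z _ (Q_L2 k)).
apply: big1 => k _; rewrite ipZl//.
by have [_ ->] := Q_perp_lower k (poly_space_lower ml pm); rewrite mulr0.
Qed.

Lemma moment_matrixE l i k : moment_matrix jj X Q l i k =
  ip P (fun w => Q (jj l i) (X w)) (fun w => Q (jj l k) (X w)).
Proof.
rewrite /moment_matrix /mxexpectation /mxRintegral mxE.
by apply: eq_Rintegral => w _; rewrite mxE big_ord1 !mxE.
Qed.

(** The matrix invmx G equals W^T W, which is invertible. *)
Lemma moment_matrix_unit l : moment_matrix jj X Q l \in unitmx.
Proof.
rewrite -unitmx_inv -(whitening_inv W_whitening) unitmx_mul unitmx_tr.
by rewrite (whitening_unit W_whitening).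
Qed.

(** From W^T W = G^-1 one gets G = W^-1 W^-T. *)
Lemma whitening_moment l : W l *m moment_matrix jj X Q l *m (W l)^T = 1%:M.
Proof.
have Wu := whitening_unit W_whitening l.
rewrite -[moment_matrix _ _ _ _]invmxK -(whitening_inv W_whitening).
have WTu : (W l)^T \in unitmx by rewrite unitmx_tr.
have WWu : (W l)^T *m W l \in unitmx by rewrite unitmx_mul WTu.
rewrite -[LHS](mulmxK Wu) -[RHS](mulmxV Wu); congr (_ *m _).
by rewrite -!mulmxA mulVmx// mulmx1.
Qed.

Lemma psi_orthonormal l i l' i' :
  ip P (fun w => psi l i (X w)) (fun w => psi l' i' (X w)) =
  ((l == l') && (i == i' :> nat))%:R.
Proof.
have [ll'|l'l|ll'] := ltngtP l l'; first by have [] := psi_perp_poly i' ll' (psi_poly i).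
  by rewrite ipC; have [] := psi_perp_poly i l'l (psi_poly i').
subst l' => /=; have /matrixP/(_ i i') := whitening_moment l.
rewrite [in RHS]mxE (inj_eq val_inj) => <-.
have -> : (fun w => psi l i (X w)) = fun w => \sum_k W l i k * Q (jj l k) (X w).
  by apply/funext => w; rewrite psiE.
have WQ2 j k : L2 P (fun w => W l j k * Q (jj l k) (X w)).
  exact: (L2Z _ (Q_L2 k)).
rewrite ip_suml//; last exact: psi_L2.
rewrite -mulmxA mxE; apply: eq_bigr => k _; rewrite ipZl//; [|exact: psi_L2].
congr (_ * _); rewrite ipC.
have -> : (fun w => psi l i' (X w)) = fun w => \sum_k W l i' k * Q (jj l k) (X w).
  by apply/funext => w; rewrite psiE.
rewrite ip_suml// mxE; apply: eq_bigr => k' _; rewrite ipZl// [(_)^T _ _]mxE mulrC.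
by rewrite moment_matrixE ipC.
Qed.

Definition Psi_upto m : set ('rV[R]_N -> R) :=
  lin_span [set u | exists l i, (l <= m)%N /\ u = psi l i].

(** The coefficients [c] of the monomials of top degree form, when p runs over
    the entries of Q_l, the leading coefficient matrix C_l. *)
Lemma poly_space_top l p : poly_space l p ->
  exists (c : 'I_(K N l) -> R) q, poly_lower l q /\
    forall x, p x = \sum_i c i * monomial (jj l i) x + q x.
Proof.
move: p; pose C : set ('rV[R]_N -> R) := [set p | exists (c : 'I_(K N l) -> R) q,
  poly_lower l q /\ forall x, p x = \sum_i c i * monomial (jj l i) x + q x].
apply: (@lin_span_ind _ _ _ C).
- exists (fun=> 0), (fun=> 0); split; first exact: lin_span0.
  by move=> x; rewrite big1 ?addr0// => i _; rewrite mul0r.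
- move=> u v [c [q [lq uE]]] [c' [q' [lq' vE]]].
  exists (fun i => c i + c' i), (fun x => q x + q' x); split; first exact: lin_spanD.
  move=> x; rewrite uE vE addrACA; congr (_ + _); rewrite -big_split.
  by apply: eq_bigr => i _; rewrite mulrDl.
- move=> a _ [j /= jl <-].
  have [jl'|jl'] := ltnP (mdegree j) l.
    exists (fun=> 0), (fun x => a * monomial j x); split.
      by apply: lin_spanZ; apply: sub_lin_span; exists j.
    by move=> x; rewrite big1 ?add0r// => i _; rewrite mul0r.
  have [i <-] : exists i, jj l i = j.
    by apply: (listing_surj jj_listing); apply/eqP; rewrite eqn_leq jl.
  exists (fun k => a *+ (k == i)), (fun=> 0); split; first exact: lin_span0.
  move=> x; rewrite addr0 (bigD1 i)//= eqxx big1 ?addr0// => k /negbTE ->.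
  by rewrite mul0r.
Qed.

Lemma Psi_upto_le m n p : (m <= n)%N -> Psi_upto m p -> Psi_upto n p.
Proof.
move=> mn; apply: lin_span_subset => _ [l [i [lm ->]]]; apply: sub_lin_span.
by exists l, i; split => //; exact: leq_trans mn.
Qed.

Lemma Q_Psi_upto l k : Psi_upto l (Q (jj l k)).
Proof.
rewrite (_ : Q _ = fun x => \sum_i invmx (W l) k i * psi l i x); last first.
  apply/funext => x; have Wu := whitening_unit W_whitening l.
  have /matrixP/(_ k ord0) := mulKmx Wu (graded_col jj Q l x).
  by rewrite !mxE.
apply: lin_span_sum => i; apply: lin_spanZ; apply: sub_lin_span.
by exists l, i.
Qed.

(** Induction on the degree l.  Since Q_l = C_l x_l + q with q of lower degree
    and Q_l is orthogonal to q, the moment matrix is C_l S; it is invertible, so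
    C_l is too, and x_l = C_l^-1 (Q_l - q). *)
Lemma monomial_Psi_upto j : Psi_upto (mdegree j) (@monomial R N j).
Proof.
have [n] := ubnP (mdegree j); elim: n j => // n ih j jn.
set l := mdegree j in jn *.
have [i jE] := listing_surj jj_listing (erefl l).
have [c cP] := choice (fun k => poly_space_top (@Q_poly l k)).
have [q qP] := choice cP.
pose Cm := \matrix_(k, i) c k i.
pose S := \matrix_(i, k) ip P (fun w => monomial (jj l i) (X w))
  (fun w => Q (jj l k) (X w)).
have mono2 a : L2 P (fun w => monomial a (X w)).
  exact: (L2_poly X_input (poly_space_monomial (leqnn _))).
have qlow k : poly_lower l (q k) by have [] := qP k.
have q2 k : L2 P (fun w => q k (X w)).
  exact: (L2_poly X_input (poly_lowerW (qlow k))).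
have GE : moment_matrix jj X Q l = Cm *m S.
  apply/matrixP => k k'; rewrite moment_matrixE mxE.
  have -> : (fun w => Q (jj l k) (X w)) = fun w =>
      \sum_i c k i * monomial (jj l i) (X w) + q k (X w).
    by apply/funext => w; have [_ ->] := qP k.
  have cm2 a : L2 P (fun w => c k a * monomial (jj l a) (X w)).
    exact: (L2Z _ (mono2 _)).
  rewrite ipDl//; last exact: L2_sum.
  have [_] := Q_perp_lower k' (qlow k); rewrite ipC => ->; rewrite addr0 ip_suml//.
  by apply: eq_bigr => a _; rewrite ipZl// !mxE.
have Cu : Cm \in unitmx.
  by have := moment_matrix_unit l; rewrite GE unitmx_mul => /andP[].
have -> : monomial j = fun x => \sum_k invmx Cm i k * (Q (jj l k) x + -1 * q k x).
  apply/funext => x; pose qc := \col_k q k x.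
  have QE : Cm *m graded_col jj (@monomial R N) l x = graded_col jj Q l x - qc.
    apply/colP => k; rewrite !mxE; have [_ ->] := qP k; rewrite addrK.
    by apply: eq_bigr => a _; rewrite !mxE.
  have /colP/(_ i) := mulKmx Cu (graded_col jj (@monomial R N) l x).
  rewrite QE [in RHS]mxE jE => <-; rewrite mxE; apply: eq_bigr => k _.
  by rewrite !mxE mulN1r.
apply: lin_span_sum => k; apply: lin_spanZ; apply: lin_spanD.
  exact: Q_Psi_upto.
apply: lin_spanZ; have [lq _] := qP k.
apply: lin_span_subset lq => _ [a /= al <-].
apply: Psi_upto_le (ltnW al) _; apply: ih; exact: leq_trans al _.
Qed.

Lemma poly_space_Psi_upto m p : poly_space m p -> Psi_upto m p.
Proof.
apply: lin_span_subset => _ [j /= jm <-].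
exact: Psi_upto_le jm (monomial_Psi_upto j).
Qed.

Section error.
Variable y : 'rV[R]_N -> R.
Hypothesis y2 : L2 P (fun w => y (X w)).

Let Y w := y (X w).
Let ym m w := pce jj X Q W y m (X w).

Lemma pceE m w : ym m w =
  \sum_(l < m.+1) \sum_i ip P Y (fun w => psi l i (X w)) * psi l i (X w).
Proof.
apply: eq_bigr => l _; rewrite mxE; apply: eq_bigr => i _; congr (_ * _).
by rewrite mxE [LHS]mxE; apply: eq_Rintegral => t _; rewrite mxE.
Qed.

Lemma pce_L2 m : L2 P (ym m).
Proof.
rewrite (_ : ym m = fun w => \sum_(l < m.+1) \sum_i
  ip P Y (fun w => psi l i (X w)) * psi l i (X w)).
  by apply: L2_sum => l _; apply: L2_sum => i _; exact: (L2Z _ (psi_L2 i)).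
by apply/funext => w; exact: pceE.
Qed.

Lemma error_L2 m : L2 P (fun w => Y w - ym m w).
Proof. by apply: L2B => //; exact: pce_L2. Qed.

Lemma error_perp_psi m l i : (l <= m)%N ->
  perp P (fun w => Y w - ym m w) (fun w => psi l i (X w)).
Proof.
move=> lm; split; first exact: psi_L2.
have p2 := psi_L2 i; rewrite ipBl//; last exact: pce_L2.
rewrite (_ : ym m = fun w => \sum_(l < m.+1) \sum_i
  ip P Y (fun w => psi l i (X w)) * psi l i (X w)); last first.
  by apply/funext => w; exact: pceE.
have t2 (l' : 'I_m.+1) i' : L2 P (fun w =>
    ip P Y (fun w => psi l' i' (X w)) * psi l' i' (X w)).
  exact: (L2Z _ (psi_L2 i')).
rewrite ip_suml//; last by move=> l'; exact: L2_sum.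
pose l0 : 'I_m.+1 := Ordinal (lm : (l < m.+1)%N).
rewrite (bigD1 l0)//= [X in _ - (_ + X)]big1 => [|l' l'l]; last first.
  rewrite ip_suml//; apply: big1 => i' _.
  rewrite ipZl//; last exact: psi_L2.
  rewrite psi_orthonormal (_ : (l' == l :> nat) = false) ?mulr0//.
  by apply/negbTE; move: l'l; rewrite -val_eqE.
rewrite addr0 ip_suml//; last exact: (t2 l0).
rewrite (bigD1 i)//= ipZl// psi_orthonormal !eqxx mulr1 big1 ?addr0 ?subrr//.
move=> i' i'i; rewrite ipZl//; last exact: psi_L2.
rewrite psi_orthonormal eqxx /= (_ : (i' == i :> nat) = false) ?mulr0//.
by apply/negbTE; move: i'i; rewrite -val_eqE.
Qed.

Lemma error_perp_Psi_upto m p : Psi_upto m p ->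
  perp P (fun w => Y w - ym m w) (fun w => p (X w)).
Proof.
move=> /(lin_span_comp X) pm; apply: (lin_span_perp (error_L2 m) _ pm).
by move=> _ [_ [l [i [lm ->]]] <-]; exact: error_perp_psi.
Qed.

(** The difference y_m - p lies in the span of the Psi_j with |j| <= m, to which
    the error is orthogonal. *)
Lemma sqdist_pce_le m p : poly_space m p ->
  sqdist P Y (ym m) <= sqdist P Y (fun w => p (X w)).
Proof.
move=> pm; apply: perp_sqdist_le => //; first exact: pce_L2.
have pce_upto : Psi_upto m (pce jj X Q W y m).
  rewrite (_ : pce jj X Q W y m = fun x => \sum_(l < m.+1) \sum_i
    (pce_coef jj X Q W y l)^T ord0 i * psi l i x); last first.
    by apply/funext => x; apply: eq_bigr => l _; rewrite mxE.
  apply: lin_span_sum => l; apply: lin_span_sum => i; apply: lin_spanZ.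
  by apply: sub_lin_span; exists l, i; split => //; rewrite -ltnS.
apply: (@error_perp_Psi_upto m (fun x => pce jj X Q W y m x - p x)).
rewrite (_ : (fun x => _) = fun x => pce jj X Q W y m x + -1 * p x); last first.
  by apply/funext => x; rewrite mulN1r.
by apply: lin_spanD => //; apply: lin_spanZ; exact: poly_space_Psi_upto.
Qed.

Lemma error_perp_Psi_dsum m Z : Psi_dsum jj X Q W m Z ->
  perp P (fun w => Y w - ym m w) Z.
Proof.
move=> [z [zl ZE]]; rewrite (_ : Z = fun w => \sum_(l < m.+1) z l w); last exact/funext.
have zperp (l : 'I_m.+1) : perp P (fun w => Y w - ym m w) (z l).
  apply: (lin_span_perp (error_L2 m) _ (zl l)) => _ [i _ <-].
  by apply: error_perp_psi; rewrite -ltnS.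
split; first by apply: L2_sum => l _; have [] := zperp l.
rewrite ipC ip_suml//; [|by move=> l; have [] := zperp l|exact: error_L2].
by apply: big1 => l _; rewrite ipC; have [] := zperp l.
Qed.

End error.

End projection.

(** * The truncated expansion *)

Theorem proposition14 (R : realType) (d : measure_display)
    (Omega : measurableType d) (P : probability Omega R)
    (P_complete : measure_is_complete P)
    (N : nat) (N_gt0 : (0 < N)%N)
    (A : set 'rV[R]_N) (X : {RV P >-> 'rV[R]_N}) (f : 'rV[R]_N -> R)
    (nrm : 'rV[R]_N -> R) (nrm_norm : is_norm nrm)
    (X_input : input_assumption A X f nrm)
    (le : rel (multiindex N)) (le_order : monomial_order le)
    (jj : forall l, 'I_(K N l) -> multiindex N)
    (jj_listing : monomial_listing le jj)
    (Q : multiindex N -> 'rV[R]_N -> R)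
    (Q_orthogonal : orthogonal_polynomials jj A f Q)
    (W : forall l, 'M[R]_(K N l)) (W_whitening : whitening jj X Q W)
    (y : 'rV[R]_N -> R) (y_measurable : measurable_fun A y)
    (y_L2 : ('E_P[fun w => (y (X w) ^+ 2)%R] < +oo)%E) :
  (forall (m : nat) (Z : Omega -> R), Psi_dsum jj X Q W m Z ->
     L2_orthogonal P (fun w => y (X w) - pce jj X Q W y m (X w)) Z) /\
  (fun m : nat => 'E_P[fun w => ((y (X w) - pce jj X Q W y m (X w)) ^+ 2)%R]%E)
    @ \oo --> 0%E.
Proof.
have y2 : L2 P (fun w => y (X w)).
  have mX : measurable_fun setT X by exact: measurable_funPT.
  have my : measurable_fun setT (fun w => y (X w)).
    rewrite (_ : (fun w => y (X w)) = (y \_ A) \o X); last first.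
      by apply/funext => w; rewrite /= patchE mem_set//; exact: input_range X_input w.
    apply: measurableT_comp => //.
    by apply/(measurable_restrictT _ _).1 => //; exact: input_domain X_input.
  apply/L2P; split => //; apply/integrableP; split.
    by apply/measurable_EFinP; exact: measurable_funX.
  move: y_L2; rewrite unlock; apply: le_lt_trans.
  rewrite le_eqVlt; apply/orP; left; apply/eqP; apply: eq_integral => w _ /=.
  by rewrite ger0_norm ?sqr_ge0.
have e2 m := error_L2 X_input jj_listing Q_orthogonal W y2 m.
split=> [m Z /(error_perp_Psi_dsum X_input jj_listing Q_orthogonal W_whitening y2)|].
  move=> [Z2 EZ]; split => //; first exact: e2.
  rewrite unlock -[LHS]fineK; first by rewrite [fine _]EZ.
  by apply: integrable_fin_num => //; exact: (L2_integrableM (e2 m) Z2).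
pose D m := sqdist P (fun w => y (X w)) (fun w => pce jj X Q W y m (X w)).
rewrite (_ : (fun m => _) = EFin \o D); last first.
  apply/funext => m; rewrite unlock /= -[LHS]fineK//.
  by apply: integrable_fin_num => //; have /L2P[] := e2 m.
apply: cvg_EFin; first exact: nearW.
apply/cvgrPdist_lt => e e0.
have [_ /(_ e e0)[_ [n [p [pn ->]]] pe]] :=
  polynomials_dense nrm_norm X_input y_measurable y2.
exists n => // m /= nm; rewrite sub0r normrN ger0_norm ?sqdist_ge0//.
apply: le_lt_trans pe.
exact: (sqdist_pce_le X_input jj_listing Q_orthogonal W_whitening y2
  (poly_space_le nm pn)).
Qed.
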